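(* Let $\mathcal M$ be a strict (symmetric) monoidal category with monoidal pointing $P:\mathcal B\to\mathcal M$. If $P$ is a fully factorizable pointing of $\mathcal M$, then the elements of $\mathrm{Hom}_{\mathcal{P}l_\otimes(\mathcal M,P)_{red}}(\phi,\psi)$ are equivalence classes of roofs given by pairs consisting of a decomposition $\phi=\phi_1\otimes\dots\otimes\phi_n$ and a morphism $\boldsymbol\Gamma$, where the latter can be taken to be a box diagram with a valid decoration by the morphisms $\phi_1,\dots,\phi_n$ and a choice of base morphisms such that the target is $\psi$; or, equivalently, a composition graph with this decoration. More generally, if the pointing is only factorizable, the morphisms of $\mathcal{P}l_\otimes(\mathcal M,P)_{red}$ represented by roofs given by pairs consisting of a decomposition $\phi=\phi_1\otimes\dots\otimes\phi_n$ and a morphism $\boldsymbol\Gamma$ given by a box diagram (or, equivalently, a composition graph) with a valid decoration by the morphisms $\phi_1,\dots,\phi_n$ and a choice of base morphisms generate the morphisms of $\mathcal{P}l_\otimes(\mathcal M,P)_{red}$ under the monoidal product and composition.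
   Context: **Pointing.** $P$ is identity-on-objects and strict (symmetric) monoidal; morphisms $P(\sigma)$ are base morphisms; $(\sigma,\sigma')\phi=P(\sigma')\phi P(\sigma)=:\sigma'\phi\sigma$. - *Factorizable*: for $(\sigma,\sigma')$ acting on $\phi_1\otimes\phi_2$ there are $(\sigma_i,\sigma_i')$ and $\psi_i$ with $(\sigma,\sigma')(\phi_1\otimes\phi_2)=(\sigma_1,\sigma_1')\psi_1\otimes(\sigma_2,\sigma_2')\psi_2$, or in the symmetric case alternatively $(\sigma,\sigma')(C_{12},C_{12})(\phi_1\otimes\phi_2)=(\sigma_1,\sigma_1')\psi_1\otimes(\sigma_2,\sigma_2')\psi_2$. - *Localizable*: (1) if $(\sigma,\sigma')\phi=\psi_1\otimes\psi_2$ there are $\phi_1,\phi_2$ and $(\sigma_i,\sigma_i')$ with $\phi=\phi_1\otimes\phi_2$ and $\psi_i=(\sigma_i,\sigma_i')\phi_i$, or $\psi_1=(\sigma_1,\sigma_1')\phi_2$, $\psi_2=(\sigma_2,\sigma_2')\phi_1$; (2) if $\phi_1\otimes\phi_2=\psi_1\otimes\psi_2$ there is $\chi$ with $\phi_1=\psi_1\otimes\chi$, $\psi_2=\chi\otimes\phi_2$; (3) if $\phi_1\circ\phi_2=\psi_1\otimes\psi_2$ there are $\chi_i$ with $\phi_1=\chi_1\otimes\chi_2$, $\phi_2=\chi_3\otimes\chi_4$, $\psi_1=\chi_1\chi_3$, $\psi_2=\chi_2\chi_4$. - *Fully factorizable*: factorizable and localizable. **Plus constructions.** $(P^{op}\downarrow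 P)$ has objects $(X,Y;\phi:P(X)\to P(Y))$ and morphisms $(\sigma,\sigma'):\phi\to\sigma'\phi\sigma$. $\mathcal{P}l_\otimes(\mathcal M,P)$ is obtained from the free (symmetric) monoidal category $(P^{op}\downarrow P)^\boxtimes$ by adjoining $\gamma_{\phi_1,\phi_0}:\phi_1\boxtimes\phi_0\to\phi_1\phi_0$, $\mu_{\phi_1,\phi_2}:\phi_1\boxtimes\phi_2\to\phi_1\otimes\phi_2$, $\mu_1:1_\boxtimes\to id_1$, modulo: $(\sigma,\sigma')\gamma_{\phi_1,\phi_0}=\gamma_{\sigma'\phi_1,\phi_0\sigma}[(id,\sigma')\boxtimes(\sigma,id)]$; $\gamma_{\phi_1,\sigma\phi_0}[id\boxtimes(id,\sigma)]=\gamma_{\phi_1\sigma,\phi_0}[(\sigma,id)\boxtimes id]$; associativity of $\gamma$ and $\mu$; $\mu[(\sigma_1,\sigma_1')\boxtimes(\sigma_2,\sigma_2')]=(\sigma_1\otimes\sigma_2,\sigma_1'\otimes\sigma_2')\mu$; unitality of $\mu_1$; $\gamma_{\phi_1\otimes\psi_1,\phi_0\otimes\psi_0}[\mu\boxtimes\mu]\tau^{23}=\mu[\gamma_{\phi_1,\phi_0}\boxtimes\gamma_{\psi_1,\psi_0}]$; in the symmetric case $\mu_{\psi,\phi}\tau^{12}=(C_{12},C_{12})\mu_{\phi,\psi}$. $\mathcal{P}l_\otimes(\mathcal M,P)_{loc}$ inverts all $\mu$'s; $\mathcal{P}l_\otimes(\mathcal M,P)_{red}$ is its full monoidal subcategory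 on the objects of $(P^{op}\downarrow P)$ (one-letter words), with product $\otimes$. **Roofs.** A pair $(\phi=\phi_1\otimes\dots\otimes\phi_n,\ \boldsymbol\Gamma:\phi_1\boxtimes\dots\boxtimes\phi_n\to\psi)$ with $\boldsymbol\Gamma$ in $\mathcal{P}l_\otimes(\mathcal M,P)$ represents the roof $\phi\xleftarrow{\mu}\phi_1\boxtimes\dots\boxtimes\phi_n\xrightarrow{\boldsymbol\Gamma}\psi$, where $\mu$ is the iterated $\mu$-morphism. Two roofs $(m_1,f_1)$, $(m_2,f_2)$ are equivalent iff there are $m_l,m_r$ composed of $\mu$-morphisms and identities with common source such that $m_1m_l=m_2m_r$ and $f_1m_l=f_2m_r$. **Box diagrams.** A (basic, decomposable) box diagram is a class of subdivisions of the unit square into boxes obtained by iterated horizontal or vertical subdivision, modulo isotopies of segments: horizontal segments may move without crossing each other and without breaking T-junctions, but may be aligned to form four-point crossings and such crossings may be broken; vertical segments may move without crossing each other or intersection points. A valid decoration labels boxes by morphisms of $\mathcal M$ and horizontal segments (including top and bottom) by base morphisms, so that for each full horizontal segment the tensor product of the base morphisms of its sub-segments goes from the tensor product of the targets of the boxes bordering from above to the tensor product of the sources of the boxes bordering from below (top and bottom constrained on one side only). Together with an enumeration of boxes, it gives a morphism of $\mathcal{P}l_\otimes(\mathcal M,P)$ with source the $\boxtimes$-product of the labels of the boxes and target the total composite (vertical juxtaposition top to bottom is composition, horizontal is $\otimes$). The composition graph is the dual directed bipartite planar graph: white vertices = boxes, black vertices = horizontal segments, edges = incidences, directed downward.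
   Formalization: In the equivalence of roofs the equation f1 m_l = f2 m_r is taken in the localization, as in the unlocalized category the claim fails for every pointing (roofs built from γ on id_1); localizability (1) also splits (σ,σ'), and (2) allows either side to be the longer. *)

(* Defs.v *)
From mathcomp Require Import all_boot.

Set Implicit Arguments.
Unset Strict Implicit.
Unset Printing Implicit Defensive.

(******************************************************************************)
(* Strict monoidal categories over a fixed monoid of objects.                 *)
(* They are presented by their arrows, as category objects in monoids, so     *)
(* that strictness is plain equality and no transport along equalities of     *)
(* objects is needed. [mcomp f g] is f after g; it is a total function, but   *)
(* it is meaningful, and is constrained, only when [src f = tgt g].           *)
(******************************************************************************)

Record obj_monoid := ObjMonoid {
  obj :> Type;
  oneO : obj;
  tenO : obj -> obj -> obj;
  tenOA : associative tenO;
  ten1O : left_id oneO tenO;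
  tenO1 : right_id oneO tenO }.

Record moncat (O : obj_monoid) := MonCat {
  mor : Type;
  src : mor -> O;
  tgt : mor -> O;
  idm : O -> mor;
  mcomp : mor -> mor -> mor;
  ten : mor -> mor -> mor;
  src_id : forall x, src (idm x) = x;
  tgt_id : forall x, tgt (idm x) = x;
  src_comp : forall f g, src f = tgt g -> src (mcomp f g) = src g;
  tgt_comp : forall f g, src f = tgt g -> tgt (mcomp f g) = tgt f;
  mcompA : forall f g h, src f = tgt g -> src g = tgt h ->
    mcomp f (mcomp g h) = mcomp (mcomp f g) h;
  comp_idl : forall f, mcomp (idm (tgt f)) f = f;
  comp_idr : forall f, mcomp f (idm (src f)) = f;
  src_ten : forall f g, src (ten f g) = tenO (src f) (src g);
  tgt_ten : forall f g, tgt (ten f g) = tenO (tgt f) (tgt g);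
  ten_id : forall x y, ten (idm x) (idm y) = idm (tenO x y);
  ten_comp : forall f f' g g', src f = tgt f' -> src g = tgt g' ->
    ten (mcomp f f') (mcomp g g') = mcomp (ten f g) (ten f' g');
  tenA : associative ten;
  ten1l : left_id (idm (oneO O)) ten;
  ten1r : right_id (idm (oneO O)) ten }.

Arguments idm {O m} x.
Arguments src {O m} f.
Arguments tgt {O m} f.
Arguments mcomp {O m} f g.
Arguments ten {O m} f g.

Record symmetry (O : obj_monoid) (M : moncat O) := Symmetry {
  braid : O -> O -> mor M;
  src_braid : forall x y, src (braid x y) = tenO x y;
  tgt_braid : forall x y, tgt (braid x y) = tenO y x;
  braid_nat : forall f g : mor M,
    mcomp (braid (tgt f) (tgt g)) (ten f g)
    = mcomp (ten g f) (braid (src f) (src g));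
  braidK : forall x y, mcomp (braid y x) (braid x y) = idm (tenO x y);
  braid_tenr : forall x y z, braid x (tenO y z)
    = mcomp (ten (idm y) (braid x z)) (ten (braid x y) (idm z)) }.

(* The base and the pointed category have the same monoid of objects, so a    *)
(* pointing is the identity on objects by construction.                       *)
Record pointing (O : obj_monoid) (B M : moncat O) := Pointing {
  pmor :> mor B -> mor M;
  src_p : forall s, src (pmor s) = src s;
  tgt_p : forall s, tgt (pmor s) = tgt s;
  p_id : forall x, pmor (idm x) = idm x;
  p_comp : forall s t, src s = tgt t -> pmor (mcomp s t) = mcomp (pmor s) (pmor t);
  p_ten : forall s t, pmor (ten s t) = ten (pmor s) (pmor t) }.

Record sym_pointing (O : obj_monoid) (B M : moncat O) (P : pointing B M) :=
  SymPointing {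
  symB : symmetry B;
  symM : symmetry M;
  p_braid : forall x y, P (braid symB x y) = braid symM x y }.

(******************************************************************************)
(* Throughout, [S = None] is the monoidal case and [S = Some _] the symmetric *)
(* monoidal case.                                                             *)
(******************************************************************************)

Section Pointings.
Variables (O : obj_monoid) (B M : moncat O) (P : pointing B M).
Variable S : option (sym_pointing P).

Implicit Types (phi psi chi : mor M).

(* [acts s s' phi] : the pair (s, s') is composable with phi. *)
Definition acts (s s' : mor B) phi := tgt s = src phi /\ src s' = tgt phi.

Definition act (s s' : mor B) phi : mor M := mcomp (P s') (mcomp phi (P s)).

(* The two base morphisms in (C_12, C_12), acting on phi1 ten phi2. *)
Definition Csrc (Y : sym_pointing P) phi1 phi2 : mor B :=
  braid (symB Y) (src phi2) (src phi1).
Definition Ctgt (Y : sym_pointing P) phi1 phi2 : mor B :=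
  braid (symB Y) (tgt phi1) (tgt phi2).

Definition factors (theta : mor M) :=
  exists psi1 psi2 s1 s1' s2 s2',
    [/\ acts s1 s1' psi1, acts s2 s2' psi2 &
        theta = ten (act s1 s1' psi1) (act s2 s2' psi2)].

Definition factorizable :=
  forall phi1 phi2 s s', acts s s' (ten phi1 phi2) ->
    factors (act s s' (ten phi1 phi2)) \/
    (if S is Some Y then
       let swapped := act (Csrc Y phi1 phi2) (Ctgt Y phi1 phi2) (ten phi1 phi2) in
       acts s s' swapped /\ factors (act s s' swapped)
     else False).

(* Condition (1) is about (s, s') as a morphism phi -> psi1 ten psi2: the     *)
(* pair itself is split, not only its target.                                 *)
Definition localizable1 :=
  forall phi psi1 psi2 s s', acts s s' phi -> act s s' phi = ten psi1 psi2 ->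
    exists phi1 phi2 s1 s1' s2 s2', phi = ten phi1 phi2 /\
      ([/\ acts s1 s1' phi1, acts s2 s2' phi2,
           psi1 = act s1 s1' phi1, psi2 = act s2 s2' phi2 &
           s = ten s1 s2 /\ s' = ten s1' s2'] \/
       (if S is Some Y then
          [/\ acts s1 s1' phi2, acts s2 s2' phi1,
              psi1 = act s1 s1' phi2, psi2 = act s2 s2' phi1 &
              s = mcomp (Csrc Y phi1 phi2) (ten s1 s2) /\
              s' = mcomp (ten s1' s2') (Ctgt Y phi1 phi2)]
        else False)).

(* Which of phi1 and psi1 is the longer one is not prescribed. *)
Definition localizable2 :=
  forall phi1 phi2 psi1 psi2, ten phi1 phi2 = ten psi1 psi2 ->
    exists chi, (phi1 = ten psi1 chi /\ psi2 = ten chi phi2) \/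
                (psi1 = ten phi1 chi /\ phi2 = ten chi psi2).

Definition localizable3 :=
  forall phi1 phi2 psi1 psi2, src phi1 = tgt phi2 ->
    mcomp phi1 phi2 = ten psi1 psi2 ->
    exists chi1 chi2 chi3 chi4,
      [/\ phi1 = ten chi1 chi2, phi2 = ten chi3 chi4,
          src chi1 = tgt chi3 /\ src chi2 = tgt chi4,
          psi1 = mcomp chi1 chi3 & psi2 = mcomp chi2 chi4].

Definition localizable := [/\ localizable1, localizable2 & localizable3].

Definition fully_factorizable := factorizable /\ localizable.

(* Prescribing the first alternative in (2) is a much stronger condition: it  *)
(* makes every morphism invertible for the monoidal product. It implies the   *)
(* conditions above.                                                          *)
Lemma one_sided_localizable :
  (forall phi1 phi2 psi1 psi2 : mor M, ten phi1 phi2 = ten psi1 psi2 ->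
     exists chi, phi1 = ten psi1 chi /\ psi2 = ten chi phi2) ->
  localizable.
Proof.
move=> H.
have inv f : exists g, ten f g = idm (oneO O) /\ ten g f = idm (oneO O) :> mor M.
  have [|g [E1 E2]] := H (idm (oneO O)) f f (idm (oneO O)).
    by rewrite ten1l ten1r.
  by exists g.
split.
- move=> phi psi1 psi2 s s' [a1 a2] E.
  have [g [g1 g2]] := inv psi1.
  have sg : tenO (src psi1) (src g) = oneO O by rewrite -src_ten g1 src_id.
  have tg : tenO (tgt psi1) (tgt g) = oneO O by rewrite -tgt_ten g1 tgt_id.
  have sg' : tenO (src g) (src psi1) = oneO O by rewrite -src_ten g2 src_id.
  have tg' : tenO (tgt g) (tgt psi1) = oneO O by rewrite -tgt_ten g2 tgt_id.
  have c1 : src phi = tgt (P s) by rewrite tgt_p.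
  have c2 : src (P s') = tgt (mcomp phi (P s)) by rewrite src_p a2 tgt_comp.
  exists psi1, (ten g phi), (idm (src psi1)), (idm (tgt psi1)),
    (ten (idm (src g)) s), (ten (idm (tgt g)) s').
  rewrite tenA g1 ten1l; split=> //; left; split.
  + by split; rewrite ?tgt_id ?src_id.
  + by split; rewrite !(src_ten, tgt_ten, src_id, tgt_id) ?a1 ?a2.
  + by rewrite /act !p_id comp_idr comp_idl.
  + rewrite /act !p_ten !p_id -!ten_comp ?src_ten ?tgt_ten ?src_id ?tgt_id //.
      by rewrite comp_idr comp_idl -/(act s s' phi) E tenA g2 ten1l.
    by rewrite tgt_comp ?tgt_id.
  + rewrite !tenA !ten_id sg tg !ten1l //.
- move=> p1 p2 q1 q2 /H[chi [E1 E2]]; exists chi; by left.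
- move=> p1 p2 q1 q2 c E.
  have [g [g1 g2]] := inv q1.
  have tg : tenO (tgt q1) (tgt g) = oneO O by rewrite -tgt_ten g1 tgt_id.
  have tg' : tenO (tgt g) (tgt q1) = oneO O by rewrite -tgt_ten g2 tgt_id.
  exists (idm (tgt q1)), (ten (idm (tgt g)) p1), q1, (ten g p2).
  rewrite tenA ten_id tg ten1l tenA g1 ten1l src_id; split=> //.
  + by rewrite src_ten tgt_ten src_id c.
  + by rewrite comp_idl.
  + rewrite -ten_comp ?src_id // comp_idl E tenA g2 ten1l //.
Qed.

(******************************************************************************)
(* The plus construction, as the strict symmetric monoidal category presented *)
(* by the letters phi : mor M, the category (P^op | P), gamma and mu.         *)
(* Arrows are raw terms [tm] with a typing relation [typed l w w' t] and an   *)
(* equality [eqt l w w' t t']; l = false is Pl, and l = true is its           *)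
(* localization, in which formal inverses of the mu's are adjoined.           *)
(* The product of words is symmetric also when M is only monoidal: tau^23     *)
(* occurs in the interchange relation between gamma and mu.                   *)
(******************************************************************************)

Definition word := seq (mor M).

Inductive tm :=
| tid of word
| tcomp of tm & tm
| tbox of tm & tm
| tswap of word & word
| tbase of mor B & mor M & mor B
| tgamma of mor M & mor M
| tmu of mor M & mor M
| tmu1
| tmuV of mor M & mor M
| tmu1V.

Inductive typed (l : bool) : word -> word -> tm -> Prop :=
| ty_id w : typed l w w (tid w)
| ty_comp w1 w2 w3 t u : typed l w2 w3 t -> typed l w1 w2 u ->
    typed l w1 w3 (tcomp t u)
| ty_box w1 w1' w2 w2' t u : typed l w1 w1' t -> typed l w2 w2' u ->
    typed l (w1 ++ w2) (w1' ++ w2') (tbox t u)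
| ty_swap w1 w2 : typed l (w1 ++ w2) (w2 ++ w1) (tswap w1 w2)
| ty_base s phi s' : acts s s' phi ->
    typed l [:: phi] [:: act s s' phi] (tbase s phi s')
| ty_gamma phi1 phi0 : src phi1 = tgt phi0 ->
    typed l [:: phi1; phi0] [:: mcomp phi1 phi0] (tgamma phi1 phi0)
| ty_mu phi1 phi2 :
    typed l [:: phi1; phi2] [:: ten phi1 phi2] (tmu phi1 phi2)
| ty_mu1 : typed l [::] [:: idm (oneO O)] tmu1
| ty_muV phi1 phi2 : l ->
    typed l [:: ten phi1 phi2] [:: phi1; phi2] (tmuV phi1 phi2)
| ty_mu1V : l -> typed l [:: idm (oneO O)] [::] tmu1V.

Local Notation "t \c u" := (tcomp t u) (at level 50, left associativity).
Local Notation "t \x u" := (tbox t u) (at level 40, left associativity).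
Local Notation id1 phi := (tid [:: phi]).

Inductive eqt (l : bool) : word -> word -> tm -> tm -> Prop :=
| eqt_refl w w' t : typed l w w' t -> eqt l w w' t t
| eqt_sym w w' t u : eqt l w w' t u -> eqt l w w' u t
| eqt_trans w w' t u v :
    eqt l w w' t u -> eqt l w w' u v -> eqt l w w' t v
| eqt_comp w1 w2 w3 t t' u u' : eqt l w2 w3 t t' -> eqt l w1 w2 u u' ->
    eqt l w1 w3 (t \c u) (t' \c u')
| eqt_box w1 w1' w2 w2' t t' u u' :
    eqt l w1 w1' t t' -> eqt l w2 w2' u u' ->
    eqt l (w1 ++ w2) (w1' ++ w2') (t \x u) (t' \x u')
| eqt_idl w w' t : typed l w w' t -> eqt l w w' (tid w' \c t) t
| eqt_idr w w' t : typed l w w' t -> eqt l w w' (t \c tid w) t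
| eqt_compA w1 w2 w3 w4 t u v :
    typed l w3 w4 t -> typed l w2 w3 u -> typed l w1 w2 v ->
    eqt l w1 w4 (t \c (u \c v)) (t \c u \c v)
| eqt_box_id w w' : eqt l (w ++ w') (w ++ w') (tid w \x tid w') (tid (w ++ w'))
| eqt_box_comp w1 w2 w3 v1 v2 v3 t t' u u' :
    typed l w2 w3 t -> typed l w1 w2 t' ->
    typed l v2 v3 u -> typed l v1 v2 u' ->
    eqt l (w1 ++ v1) (w3 ++ v3)
      ((t \c t') \x (u \c u')) ((t \x u) \c (t' \x u'))
| eqt_boxA w1 w1' w2 w2' w3 w3' t u v :
    typed l w1 w1' t -> typed l w2 w2' u -> typed l w3 w3' v ->
    eqt l (w1 ++ w2 ++ w3) (w1' ++ w2' ++ w3') (t \x (u \x v)) (t \x u \x v)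
| eqt_box1l w w' t : typed l w w' t -> eqt l w w' (tid [::] \x t) t
| eqt_box1r w w' t : typed l w w' t -> eqt l w w' (t \x tid [::]) t
| eqt_swap_nat w1 w1' w2 w2' t u : typed l w1 w1' t -> typed l w2 w2' u ->
    eqt l (w1 ++ w2) (w2' ++ w1')
      (tswap w1' w2' \c (t \x u)) ((u \x t) \c tswap w1 w2)
| eqt_swapK w1 w2 :
    eqt l (w1 ++ w2) (w1 ++ w2) (tswap w2 w1 \c tswap w1 w2) (tid (w1 ++ w2))
| eqt_swap_cat w1 w2 w3 :
    eqt l (w1 ++ w2 ++ w3) (w2 ++ w3 ++ w1) (tswap w1 (w2 ++ w3))
      ((tid w2 \x tswap w1 w3) \c (tswap w1 w2 \x tid w3))
| eqt_base_id phi :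
    eqt l [:: phi] [:: phi] (tbase (idm (src phi)) phi (idm (tgt phi))) (id1 phi)
| eqt_base_comp s1 s1' s2 s2' phi :
    acts s1 s1' phi -> acts s2 s2' (act s1 s1' phi) ->
    eqt l [:: phi] [:: act s2 s2' (act s1 s1' phi)]
      (tbase s2 (act s1 s1' phi) s2' \c tbase s1 phi s1')
      (tbase (mcomp s1 s2) phi (mcomp s2' s1'))
| eqt_gamma_outer s s' phi1 phi0 :
    src phi1 = tgt phi0 -> acts s s' (mcomp phi1 phi0) ->
    eqt l [:: phi1; phi0] [:: act s s' (mcomp phi1 phi0)]
      (tbase s (mcomp phi1 phi0) s' \c tgamma phi1 phi0)
      (tgamma (mcomp (P s') phi1) (mcomp phi0 (P s)) \c
         (tbase (idm (src phi1)) phi1 s' \x tbase s phi0 (idm (tgt phi0))))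
| eqt_gamma_inner s phi1 phi0 : tgt s = src phi1 -> src s = tgt phi0 ->
    eqt l [:: phi1; phi0] [:: mcomp phi1 (mcomp (P s) phi0)]
      (tgamma phi1 (mcomp (P s) phi0) \c
         (id1 phi1 \x tbase (idm (src phi0)) phi0 s))
      (tgamma (mcomp phi1 (P s)) phi0 \c
         (tbase s phi1 (idm (tgt phi1)) \x id1 phi0))
| eqt_gammaA phi2 phi1 phi0 : src phi2 = tgt phi1 -> src phi1 = tgt phi0 ->
    eqt l [:: phi2; phi1; phi0] [:: mcomp phi2 (mcomp phi1 phi0)]
      (tgamma (mcomp phi2 phi1) phi0 \c (tgamma phi2 phi1 \x id1 phi0))
      (tgamma phi2 (mcomp phi1 phi0) \c (id1 phi2 \x tgamma phi1 phi0))
| eqt_muA phi1 phi2 phi3 :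
    eqt l [:: phi1; phi2; phi3] [:: ten phi1 (ten phi2 phi3)]
      (tmu (ten phi1 phi2) phi3 \c (tmu phi1 phi2 \x id1 phi3))
      (tmu phi1 (ten phi2 phi3) \c (id1 phi1 \x tmu phi2 phi3))
| eqt_mu_base s1 s1' s2 s2' phi1 phi2 :
    acts s1 s1' phi1 -> acts s2 s2' phi2 ->
    eqt l [:: phi1; phi2] [:: ten (act s1 s1' phi1) (act s2 s2' phi2)]
      (tmu (act s1 s1' phi1) (act s2 s2' phi2) \c
         (tbase s1 phi1 s1' \x tbase s2 phi2 s2'))
      (tbase (ten s1 s2) (ten phi1 phi2) (ten s1' s2') \c tmu phi1 phi2)
| eqt_mu1l phi :
    eqt l [:: phi] [:: phi] (tmu (idm (oneO O)) phi \c (tmu1 \x id1 phi)) (id1 phi)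
| eqt_mu1r phi :
    eqt l [:: phi] [:: phi] (tmu phi (idm (oneO O)) \c (id1 phi \x tmu1)) (id1 phi)
| eqt_gamma_mu phi1 phi0 psi1 psi0 :
    src phi1 = tgt phi0 -> src psi1 = tgt psi0 ->
    eqt l [:: phi1; phi0; psi1; psi0]
      [:: ten (mcomp phi1 phi0) (mcomp psi1 psi0)]
      (tgamma (ten phi1 psi1) (ten phi0 psi0) \c
         (tmu phi1 psi1 \x tmu phi0 psi0) \c
         (id1 phi1 \x tswap [:: phi0] [:: psi1] \x id1 psi0))
      (tmu (mcomp phi1 phi0) (mcomp psi1 psi0) \c
         (tgamma phi1 phi0 \x tgamma psi1 psi0))
| eqt_mu_swap (Y : sym_pointing P) phi psi : S = Some Y ->
    eqt l [:: phi; psi] [:: ten psi phi]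
      (tmu psi phi \c tswap [:: phi] [:: psi])
      (tbase (Csrc Y phi psi) (ten phi psi) (Ctgt Y phi psi) \c tmu phi psi)
| eqt_muK phi1 phi2 : l ->
    eqt l [:: phi1; phi2] [:: phi1; phi2]
      (tmuV phi1 phi2 \c tmu phi1 phi2) (tid [:: phi1; phi2])
| eqt_muVK phi1 phi2 : l ->
    eqt l [:: ten phi1 phi2] [:: ten phi1 phi2]
      (tmu phi1 phi2 \c tmuV phi1 phi2) (id1 (ten phi1 phi2))
| eqt_mu1K : l -> eqt l [::] [::] (tmu1V \c tmu1) (tid [::])
| eqt_mu1VK : l -> eqt l [:: idm (oneO O)] [:: idm (oneO O)]
    (tmu1 \c tmu1V) (id1 (idm (oneO O))).

(* Arrows of the reduced category: [red phi psi] as a setoid with equality    *)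
(* [redE phi psi]; its monoidal product is that of letters, transported along *)
(* the mu's.                                                                  *)
Definition red phi psi (f : tm) := typed true [:: phi] [:: psi] f.
Definition redE phi psi (f g : tm) := eqt true [:: phi] [:: psi] f g.
Definition red_ten phi1 phi2 psi1 psi2 (f1 f2 : tm) : tm :=
  tmu psi1 psi2 \c (f1 \x f2) \c tmuV phi1 phi2.

Definition big_ten (w : word) : mor M := foldr ten (idm (oneO O)) w.

Fixpoint mu_iter (w : word) : tm :=
  match w with
  | [::] => tmu1
  | phi :: w' =>
    if w' is [::] then id1 phi else tmu phi (big_ten w') \c (id1 phi \x mu_iter w')
  end.

Fixpoint muV_iter (w : word) : tm :=
  match w with
  | [::] => tmu1V
  | phi :: w' =>
    if w' is [::] then id1 phi
    else (id1 phi \x muV_iter w') \c tmuV phi (big_ten w')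
  end.

Definition roof phi psi (w : word) (Gam : tm) :=
  [/\ w <> [::], phi = big_ten w & typed false w [:: psi] Gam].

Definition roof_mor (w : word) (Gam : tm) : tm := Gam \c muV_iter w.

(* Composites and products of mu-morphisms and identities. *)
Inductive mu_arrow : tm -> Prop :=
| mua_id w : mu_arrow (tid w)
| mua_mu phi1 phi2 : mu_arrow (tmu phi1 phi2)
| mua_mu1 : mu_arrow tmu1
| mua_comp t u : mu_arrow t -> mu_arrow u -> mu_arrow (t \c u)
| mua_box t u : mu_arrow t -> mu_arrow u -> mu_arrow (t \x u).

(* The equation between the left legs holds already before localization. The  *)
(* one between the right legs has to be read in the localization: with        *)
(* e = id_1, the roofs gamma : e e -> e and gamma (gamma e) : e e e -> e      *)
(* coincide in the localization (Eckmann-Hilton), for every pointing, but no  *)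
(* pair of mu-arrows equalizes them in Pl.                                    *)
Definition roof_equiv phi psi (w1 : word) (Gam1 : tm) (w2 : word) (Gam2 : tm) :=
  exists u ml mr,
    [/\ mu_arrow ml /\ mu_arrow mr,
        typed false u w1 ml /\ typed false u w2 mr,
        eqt false u [:: phi] (mu_iter w1 \c ml) (mu_iter w2 \c mr) &
        eqt true u [:: psi] (Gam1 \c ml) (Gam2 \c mr)].

(* Closure of a family of roofs under composition and product in the reduced  *)
(* category.                                                                  *)
Inductive generated (R : mor M -> mor M -> word -> tm -> Prop) :
    mor M -> mor M -> tm -> Prop :=
| gen_roof phi psi w Gam : R phi psi w Gam ->
    generated R phi psi (roof_mor w Gam)
| gen_comp phi psi chi g f : generated R psi chi g -> generated R phi psi f ->
    generated R phi chi (g \c f)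
| gen_ten phi1 psi1 phi2 psi2 f1 f2 :
    generated R phi1 psi1 f1 -> generated R phi2 psi2 f2 ->
    generated R (ten phi1 phi2) (ten psi1 psi2)
      (red_ten phi1 phi2 psi1 psi2 f1 f2)
| gen_eq phi psi f g : redE phi psi f g -> generated R phi psi f ->
    generated R phi psi g.

End Pointings.

(******************************************************************************)
(* Box diagrams. A class of decomposable subdivisions of the square has a     *)
(* representative in which all four-point crossings are broken; such a        *)
(* subdivision is recorded by the tree of its cuts. Each horizontal cut is    *)
(* then one full horizontal segment.                                          *)
(******************************************************************************)

Inductive subdiv :=
| Whole
| Beside of subdiv & subdiv   (* left, right *)
| Above of subdiv & subdiv.   (* upper, lower *)

Fixpoint box (d : subdiv) : finType :=
  match d with
  | Whole => unit
  | Beside a b | Above a b => (box a + box b)%type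
  end.

Fixpoint cut (d : subdiv) : Type :=
  match d with
  | Whole => void
  | Beside a b => (cut a + cut b)%type
  | Above a b => option (cut a + cut b)
  end.

Variant hseg (d : subdiv) := Top | Bottom | Cut of cut d.
Arguments Top {d}.
Arguments Bottom {d}.
Arguments Cut {d} c.

Fixpoint top_row (d : subdiv) : seq (box d) :=
  match d with
  | Whole => [:: tt]
  | Beside a b => map inl (top_row a) ++ map inr (top_row b)
  | Above a b => map inl (top_row a)
  end.

Fixpoint bottom_row (d : subdiv) : seq (box d) :=
  match d with
  | Whole => [:: tt]
  | Beside a b => map inl (bottom_row a) ++ map inr (bottom_row b)
  | Above a b => map inr (bottom_row b)
  end.

Fixpoint above_cut (d : subdiv) : cut d -> seq (box d) :=
  match d return cut d -> seq (box d) with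
  | Whole => fun c => match c with end
  | Beside a b => fun c =>
    match c with
    | inl c => map inl (above_cut c)
    | inr c => map inr (above_cut c)
    end
  | Above a b => fun c =>
    match c with
    | None => map inl (bottom_row a)
    | Some (inl c) => map inl (above_cut c)
    | Some (inr c) => map inr (above_cut c)
    end
  end.

Fixpoint below_cut (d : subdiv) : cut d -> seq (box d) :=
  match d return cut d -> seq (box d) with
  | Whole => fun c => match c with end
  | Beside a b => fun c =>
    match c with
    | inl c => map inl (below_cut c)
    | inr c => map inr (below_cut c)
    end
  | Above a b => fun c =>
    match c with
    | None => map inr (top_row b)
    | Some (inl c) => map inl (below_cut c)
    | Some (inr c) => map inr (below_cut c)
    end
  end.

Definition above d (h : hseg d) : seq (box d) :=
  match h with
  | Top => [::]
  | Bottom => bottom_row d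
  | Cut c => above_cut c
  end.

Definition below d (h : hseg d) : seq (box d) :=
  match h with
  | Top => top_row d
  | Bottom => [::]
  | Cut c => below_cut c
  end.

(******************************************************************************)
(* Directed bipartite plane graphs. [gin v] and [gout v] are the white        *)
(* neighbours of v joined to it by an incoming, resp. outgoing, edge, from    *)
(* left to right. The dual of a subdivision is its composition graph.         *)
(******************************************************************************)

Record bigraph := BiGraph {
  white : finType;
  black : Type;
  gin : black -> seq white;
  gout : black -> seq white }.

Definition dual (d : subdiv) : bigraph := BiGraph (@above d) (@below d).

Record bigraph_iso (G H : bigraph) := BiGraphIso {
  iso_w : white G -> white H;
  iso_b : black G -> black H;
  iso_w_bij : bijective iso_w;
  iso_b_bij : bijective iso_b;
  iso_in : forall v, gin (iso_b v) = map iso_w (gin v);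
  iso_out : forall v, gout (iso_b v) = map iso_w (gout v) }.

Section Decorations.
Variables (O : obj_monoid) (B M : moncat O) (P : pointing B M).
Variable S : option (sym_pointing P).

Definition big_tenO (xs : seq O) : O := foldr (@tenO O) (oneO O) xs.

(* A base morphism on a black vertex without incoming (outgoing) edges is     *)
(* unconstrained on that side; in a dual these are the top (the bottom).      *)
Definition valid_graph (G : bigraph)
    (lw : white G -> mor M) (lb : black G -> mor B) :=
  forall v,
    (gin v <> [::] -> src (lb v) = big_tenO [seq tgt (lw b) | b <- gin v]) /\
    (gout v <> [::] -> tgt (lb v) = big_tenO [seq src (lw b) | b <- gout v]).

Definition valid_diagram d (lw : box d -> mor M) (lb : hseg d -> mor B) :=
  @valid_graph (dual d) lw lb.

(* The composite of the inner part of a decorated subdivision, and the        *)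
(* corresponding morphism of Pl, whose source lists the labels in the order   *)
(* [leaves d]; gamma takes the lower factor first.                            *)
Fixpoint composite d : (box d -> mor M) -> (cut d -> mor B) -> mor M :=
  match d return (box d -> mor M) -> (cut d -> mor B) -> mor M with
  | Whole => fun lw _ => lw tt
  | Beside a b => fun lw lc =>
      ten (composite (fun x : box a => lw (inl x)) (fun c : cut a => lc (inl c)))
          (composite (fun x : box b => lw (inr x)) (fun c : cut b => lc (inr c)))
  | Above a b => fun lw lc =>
      mcomp (mcomp (composite (fun x : box b => lw (inr x))
                            (fun c : cut b => lc (Some (inr c))))
                 (P (lc None)))
           (composite (fun x : box a => lw (inl x))
                      (fun c : cut a => lc (Some (inl c))))
  end.

Fixpoint leaves d : seq (box d) :=
  match d return seq (box d) with
  | Whole => [:: tt]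
  | Beside a b => map inl (leaves a) ++ map inr (leaves b)
  | Above a b => map inr (leaves b) ++ map inl (leaves a)
  end.

Fixpoint inner_tm d : (box d -> mor M) -> (cut d -> mor B) -> tm B M :=
  match d return (box d -> mor M) -> (cut d -> mor B) -> tm B M with
  | Whole => fun lw _ => tid B [:: lw tt]
  | Beside a b => fun lw lc =>
      let la x := lw (inl x) in let ca c := lc (inl c) in
      let lb x := lw (inr x) in let cb c := lc (inr c) in
      tcomp (tmu B (composite la ca) (composite lb cb))
            (tbox (inner_tm la ca) (inner_tm lb cb))
  | Above a b => fun lw lc =>
      let la x := lw (inl x) in let ca c := lc (Some (inl c)) in
      let lb x := lw (inr x) in let cb c := lc (Some (inr c)) in
      let phi1 := composite lb cb in let phi0 := composite la ca in
      let s := lc None in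
      tcomp (tgamma B (mcomp phi1 (P s)) phi0)
            (tbox (tcomp (tbase s phi1 (idm (tgt phi1))) (inner_tm lb cb))
                  (inner_tm la ca))
  end.

(* The symmetry map f e -> map f r, for r a permutation of e. *)
Fixpoint perm_tm (T : eqType) (f : T -> mor M) (e r : seq T) : tm B M :=
  if r is x :: r' then
    let i := index x e in
    tcomp (tbox (tid B [:: f x]) (perm_tm f (rem x e) r'))
          (tbox (tswap B (map f (take i e)) [:: f x])
                (tid B (map f (drop i.+1 e))))
  else tid B [::].

Definition diagram_target d (lw : box d -> mor M) (lb : hseg d -> mor B) : mor M :=
  act P (lb Top) (lb Bottom) (composite lw (fun c => lb (Cut c))).

(* The morphism given by a decorated box diagram and an enumeration e of its  *)
(* boxes.                                                                     *)
Definition diagram_tm d (lw : box d -> mor M) (lb : hseg d -> mor B)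
    (e : seq (box d)) : tm B M :=
  tcomp (tcomp (tbase (lb Top) (composite lw (fun c => lb (Cut c))) (lb Bottom))
               (inner_tm lw (fun c => lb (Cut c))))
        (perm_tm lw e (leaves d)).

Definition box_roof (phi psi : mor M) (w : word M) (Gam : tm B M) :=
  roof P phi psi w Gam /\
  exists d (lw : box d -> mor M) (lb : hseg d -> mor B) (e : seq (box d)),
    [/\ valid_diagram lw lb, perm_eq e (enum (box d)), w = map lw e,
        psi = diagram_target lw lb &
        eqt S false w [:: psi] Gam (diagram_tm lw lb e)].

(* The same for a decorated composition graph G, which is evaluated by means  *)
(* of a box diagram of which it is the dual.                                  *)
Definition graph_roof (phi psi : mor M) (w : word M) (Gam : tm B M) :=
  roof P phi psi w Gam /\
  exists (G : bigraph) (lw : white G -> mor M) (lb : black G -> mor B)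
         (e : seq (white G)),
    [/\ valid_graph lw lb, perm_eq e (enum (white G)), w = map lw e &
        exists d (h : bigraph_iso (dual d) G) (e' : seq (box d)),
          let lw' (x : box d) := lw (iso_w h x) in
          let lb' (v : hseg d) := lb (iso_b h v) in
          [/\ e = map (iso_w h) e', psi = diagram_target lw' lb' &
              eqt S false w [:: psi] Gam (diagram_tm lw' lb' e')]].

End Decorations.

(* Main.v *)
Require Import Defs.
From mathcomp Require Import all_boot.
From Stdlib Require Import Setoid Morphisms.

Set Implicit Arguments.
Unset Strict Implicit.
Unset Printing Implicit Defensive.

(** Why the theorem holds. Conjugating an arrow t : v -> w of the localization
    with the iterated products muV_iter v and mu_iter w turns it into an arrow
    between letters. Under this operation the unit and the mu's become
    identities, composites go to composites and products to the products of
    the reduced category; hence the reduced category is generated, under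
    composition and product, by base morphisms, by the symmetries of the
    product of two letters and by the roofs of gamma ([reduction],
    [reduced_ind]). Each of these generators is the roof of a box diagram with
    one or two boxes, which is the statement about generation.

    For the sharper statement, call an arrow normal if it first splits every
    letter of its source along decompositions phi = phi1 ten ... ten phi_n,
    then permutes the resulting letters, and then applies to consecutive
    blocks of them arrows built from mu, gamma and base morphisms
    ([diagrammatic]). A normal arrow between two letters is the roof of a box
    diagram ([normal_box_roof]): its three parts are the inverse mu's of the
    left leg, the enumeration of the boxes, and the diagram; the base
    morphisms that occur in a diagrammatic arrow can be moved onto the
    horizontal segments ([diagrammatic_cut]). So it suffices that normal
    arrows are closed under composition ([normal_comp]). Shuffles move past
    blocks and past splittings by naturality, and the one step with content is
    to move an inverse mu back through a diagrammatic arrow ([dg_split]). This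
    is what localizability says: when the composite of a diagram is a product
    phi1 ten phi2, so are the total morphisms of the sub-diagrams which the
    separation meets, compatibly with the cuts; hence the diagram falls apart
    into two diagrams with targets phi1 and phi2, once the boxes which lie
    across the separation have been split.

    Two roofs with the same source are compared on a common refinement of their
    decompositions. It exists by condition (2) of localizability, which is the
    conclusion of Levi's lemma on words ([common_refinement]), and the left legs
    agree on it by coherence of mu ([mu_arrow_iter]), so that equality of roofs
    in the localization is equality of their right legs there ([roof_morP]).

    Composition graphs add nothing: a decoration of a graph is evaluated on a
    box diagram whose dual is isomorphic to it, and labels and enumerations are
    transported along this isomorphism ([box_roof_graph]). *)

Reserved Notation "t \c u" (at level 50, left associativity).
Reserved Notation "t \x u" (at level 40, left associativity).
Reserved Notation "t ~~ u" (at level 70, no associativity).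

(** * The action of pairs of base morphisms *)

Section Act.
Variables (O : obj_monoid) (B M : moncat O) (P : pointing B M).
Implicit Types (phi psi : mor M) (s t : mor B).

Lemma src_act s s' phi : acts s s' phi -> src (act P s s' phi) = src s.
Proof.
by move=> [a1 a2]; rewrite /act src_comp ?src_comp ?src_p ?tgt_p ?tgt_comp ?tgt_p.
Qed.

Lemma tgt_act s s' phi : acts s s' phi -> tgt (act P s s' phi) = tgt s'.
Proof. by move=> [a1 a2]; rewrite /act tgt_comp ?tgt_p ?tgt_comp ?src_p ?tgt_p. Qed.

Lemma acts_id phi : acts (idm (src phi) : mor B) (idm (tgt phi)) phi.
Proof. by rewrite /acts src_id tgt_id. Qed.

Lemma act_id phi : act P (idm (src phi)) (idm (tgt phi)) phi = phi.
Proof. by rewrite /act !p_id comp_idr comp_idl. Qed.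

Lemma act_src s phi : tgt s = src phi ->
  act P s (idm (tgt phi)) phi = mcomp phi (P s).
Proof.
move=> a; rewrite /act p_id -(comp_idl (mcomp phi (P s))) tgt_comp ?comp_idl ?tgt_p //.
by rewrite -(@tgt_comp _ _ phi (P s)) ?comp_idl ?tgt_p.
Qed.

Lemma act_tgt s' phi : src s' = tgt phi ->
  act P (idm (src phi)) s' phi = mcomp (P s') phi.
Proof. by move=> a; rewrite /act p_id comp_idr. Qed.

Lemma acts_comp s1 s1' s2 s2' phi :
  acts s1 s1' phi -> acts s2 s2' (act P s1 s1' phi) ->
  acts (mcomp s1 s2) (mcomp s2' s1') phi.
Proof.
move=> a [b1 b2]; move: b1 b2; rewrite src_act // tgt_act // => b1 b2.
by split; rewrite ?tgt_comp ?src_comp //; case: a.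
Qed.

Lemma act_comp s1 s1' s2 s2' phi :
  acts s1 s1' phi -> acts s2 s2' (act P s1 s1' phi) ->
  act P (mcomp s1 s2) (mcomp s2' s1') phi = act P s2 s2' (act P s1 s1' phi).
Proof.
move=> a [b1 b2]; move: b1 b2; rewrite src_act // tgt_act // => b1 b2.
case: a => a1 a2.
rewrite /act !p_comp // !mcompA ?(src_p, tgt_p, src_comp, tgt_comp) //.
Qed.

Lemma acts_ten s1 s1' s2 s2' phi1 phi2 :
  acts s1 s1' phi1 -> acts s2 s2' phi2 ->
  acts (ten s1 s2) (ten s1' s2') (ten phi1 phi2).
Proof. by case=> a1 a2 [b1 b2]; rewrite /acts !(src_ten, tgt_ten) a1 a2 b1 b2. Qed.

Lemma act_ten s1 s1' s2 s2' phi1 phi2 :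
  acts s1 s1' phi1 -> acts s2 s2' phi2 ->
  act P (ten s1 s2) (ten s1' s2') (ten phi1 phi2) =
  ten (act P s1 s1' phi1) (act P s2 s2' phi2).
Proof.
case=> a1 a2 [b1 b2].
by rewrite /act !p_ten -!ten_comp ?(src_p, tgt_p, src_comp, tgt_comp).
Qed.

Lemma acts_C (Y : sym_pointing P) phi psi :
  acts (Csrc Y phi psi) (Ctgt Y phi psi) (ten phi psi).
Proof. by rewrite /acts /Csrc /Ctgt src_braid tgt_braid src_ten tgt_ten. Qed.

Lemma act_C (Y : sym_pointing P) phi psi :
  act P (Csrc Y phi psi) (Ctgt Y phi psi) (ten phi psi) = ten psi phi.
Proof.
have [] := acts_C Y phi psi; rewrite /act /Csrc /Ctgt !p_braid => a1 a2.
rewrite mcompA ?tgt_braid ?src_ten // ?src_braid ?tgt_ten // braid_nat.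
rewrite -mcompA ?src_ten ?src_braid ?tgt_braid // braidK -src_ten.
exact: comp_idr.
Qed.

End Act.

(** * Terms up to equality *)

Section Terms.
Variables (O : obj_monoid) (B M : moncat O) (P : pointing B M).
Variable S : option (sym_pointing P).
Variable l : bool.
Implicit Types (phi psi : mor M) (s : mor B) (t u : tm B M) (w : word M).

Local Notation "t \c u" := (tcomp t u).
Local Notation "t \x u" := (tbox t u).
Local Notation tid := (@tid O B M).
Local Notation tswap := (@tswap O B M).
Local Notation typed := (@typed O B M P l).
Local Notation eqt := (@eqt O B M P S l).

(** A well-typed term has only one type, so typing is a pair of computable
    endpoints together with a condition [wt] at each node ([typedP]). *)
Fixpoint dom t : word M :=
  match t with
  | Defs.tid w => w
  | tcomp t u => dom u
  | tbox t u => dom t ++ dom u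
  | Defs.tswap w1 w2 => w1 ++ w2
  | tbase s phi s' => [:: phi]
  | tgamma phi1 phi0 => [:: phi1; phi0]
  | tmu phi1 phi2 => [:: phi1; phi2]
  | tmu1 => [::]
  | tmuV phi1 phi2 => [:: ten phi1 phi2]
  | tmu1V => [:: idm (oneO O)]
  end.

Fixpoint cod t : word M :=
  match t with
  | Defs.tid w => w
  | tcomp t u => cod t
  | tbox t u => cod t ++ cod u
  | Defs.tswap w1 w2 => w2 ++ w1
  | tbase s phi s' => [:: act P s s' phi]
  | tgamma phi1 phi0 => [:: mcomp phi1 phi0]
  | tmu phi1 phi2 => [:: ten phi1 phi2]
  | tmu1 => [:: idm (oneO O)]
  | tmuV phi1 phi2 => [:: phi1; phi2]
  | tmu1V => [::]
  end.

Fixpoint wt t : Prop :=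
  match t with
  | Defs.tid _ | Defs.tswap _ _ | tmu _ _ | tmu1 => True
  | tcomp t u => [/\ wt t, wt u & dom t = cod u]
  | tbox t u => wt t /\ wt u
  | tbase s phi s' => acts s s' phi
  | tgamma phi1 phi0 => src phi1 = tgt phi0
  | tmuV _ _ | tmu1V => l : Prop
  end.

Lemma typedP w w' t : typed w w' t <-> [/\ wt t, dom t = w & cod t = w'].
Proof.
split.
  elim=> {w w' t} //=.
  - by move=> w1 w2 w3 t u _ [? ? ?] _ [? ? ?]; split=> //; split=> //; congruence.
  - by move=> w1 w1' w2 w2' t u _ [? -> ->] _ [? -> ->].
move=> [H <- <-]; elim: t H => //=; try by move=> *; constructor.
- move=> t IHt u IHu [/IHt Ht /IHu Hu E]; rewrite E in Ht; exact: ty_comp Ht Hu.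
- by move=> t IHt u IHu [/IHt Ht /IHu Hu]; apply: ty_box.
Qed.

Lemma wt_typed t : wt t -> typed (dom t) (cod t) t.
Proof. by move=> H; apply/typedP. Qed.

Lemma typed_dom w w' t : typed w w' t -> dom t = w.
Proof. by case/typedP. Qed.
Lemma typed_cod w w' t : typed w w' t -> cod t = w'.
Proof. by case/typedP. Qed.

(** The axioms of [eqt] state one common target; on one side it is the target
    only by an identity in M, which is where the laws of M enter. *)
Lemma eqt_typed w w' t u : eqt w w' t u -> typed w w' t /\ typed w w' u.
Proof.
elim=> {w w' t u}.
- by [].
- by move=> w w' t u _ [].
- by move=> w w' t u v _ [? _] _ [].
- move=> w1 w2 w3 t t' u u' _ [? ?] _ [? ?].
  by split; apply: ty_comp; eassumption.
- by move=> w1 w1' w2 w2' t t' u u' _ [? ?] _ [? ?]; split; apply: ty_box.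
- by move=> w w' t; rewrite !typedP /= => -[? ? ->].
- by move=> w w' t; rewrite !typedP /= => -[? -> ?].
- move=> w1 w2 w3 w4 t u v; rewrite !typedP /= => -[? ? ?] [? ? ?] [? ? ?].
  by do ![split=> //]; congruence.
- by move=> *; rewrite !typedP.
- move=> w1 w2 w3 v1 v2 v3 t t' u u'; rewrite !typedP /=.
  move=> [? ? ->] [? -> ?] [? ? ->] [? -> ?].
  by do ![split=> //]; congruence.
- move=> w1 w1' w2 w2' w3 w3' t u v; rewrite !typedP /=.
  by move=> [? -> ->] [? -> ->] [? -> ->]; rewrite !catA.
- by move=> w w' t; rewrite !typedP /= => -[? -> ->].
- by move=> w w' t; rewrite !typedP /= => -[? -> ->]; rewrite !cats0.
- by move=> w1 w1' w2 w2' t u; rewrite !typedP /= => -[? -> ->] [? -> ->].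
- by move=> *; rewrite !typedP.
- by move=> w1 w2 w3; rewrite !typedP /= !catA.
- by move=> phi; rewrite !typedP /= act_id /acts src_id tgt_id.
- move=> s1 s1' s2 s2' phi a b; rewrite !typedP /= act_comp //.
  by do 2!split=> //; apply: acts_comp a b.
- move=> s s' phi1 phi0 c a; have [] := a; rewrite !typedP /=.
  rewrite src_comp // tgt_comp // => a1 a2.
  rewrite act_src // act_tgt // /acts !src_id !tgt_id.
  split; first by do !split=> //.
  split=> //; last by rewrite /act !mcompA ?(src_comp, tgt_comp, src_p, tgt_p).
  by do !split=> //; rewrite ?(src_comp, tgt_comp, src_p, tgt_p).
- move=> s phi1 phi0 a1 a2; rewrite !typedP /=.
  rewrite act_src // act_tgt // /acts !src_id !tgt_id.
  split; first by do !split=> //; rewrite ?(src_comp, tgt_comp, src_p, tgt_p).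
  do !split=> //; rewrite ?(src_comp, tgt_comp, src_p, tgt_p) //.
  by rewrite mcompA ?src_p ?tgt_p.
- move=> phi2 phi1 phi0 a1 a2; rewrite !typedP /=.
  by do !split=> //; rewrite ?(src_comp, tgt_comp) // mcompA.
- by move=> phi1 phi2 phi3; rewrite !typedP /= tenA.
- move=> s1 s1' s2 s2' phi1 phi2 a1 a2; rewrite !typedP /= act_ten //.
  by have [] := acts_ten a1 a2.
- by move=> phi; rewrite !typedP /= ten1l.
- by move=> phi; rewrite !typedP /= ten1r.
- move=> phi1 phi0 psi1 psi0 a1 a2; rewrite !typedP /= ten_comp //.
  by do !split=> //; rewrite src_ten tgt_ten a1 a2.
- by move=> Y phi psi _; rewrite !typedP /= act_C; have [] := acts_C Y phi psi.
all: by move=> *; rewrite !typedP.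
Qed.

(** Equality of terms, extended to all terms: t and u are equal to the same
    terms. On typed terms this is [eqt]; the ill-typed terms form one more
    class, so [eqv] is reflexive and is a congruence for composition and
    product without side conditions, which is what rewriting needs. *)
Definition eqv t u := forall w w' x, eqt w w' t x <-> eqt w w' u x.
Local Notation "t ~~ u" := (eqv t u).

#[global] Instance eqv_equiv : Equivalence eqv.
Proof.
split.
- by move=> t w w' v.
- by move=> t u H w w' v; rewrite H.
- by move=> t u x H1 H2 w w' v; rewrite H1.
Qed.

Lemma eqv_eqt w w' t u : t ~~ u -> typed w w' t -> eqt w w' t u.
Proof. by move=> H ty; apply: eqt_sym; apply/H; apply: eqt_refl. Qed.

Lemma eqt_eqv w w' t u : eqt w w' t u -> t ~~ u.
Proof.
move=> H v v' x.
have [/typedP[_ E1 E1'] /typedP[_ E2 E2']] := eqt_typed H.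
split=> K; have [/typedP[_ D D'] _] := eqt_typed K; apply: eqt_trans K.
  by rewrite -D -D' E1 E1'; apply: eqt_sym.
by rewrite -D -D' E2 E2'.
Qed.

Lemma eqvI t u : (wt u -> wt t) -> (wt t -> eqt (dom t) (cod t) t u) -> t ~~ u.
Proof.
move=> H1 H2 v v' x.
split=> K; have [/typedP[W D D'] _] := eqt_typed K.
  by apply: (iffLR (eqt_eqv (H2 W) _ _ _)).
by apply: (iffRL (eqt_eqv (H2 (H1 W)) _ _ _)).
Qed.

Lemma eqv_typed w w' t u : t ~~ u -> typed w w' t -> typed w w' u.
Proof. by move=> H /(eqv_eqt H)/eqt_typed[]. Qed.

#[global] Instance tcomp_eqv : Proper (eqv ==> eqv ==> eqv) (@tcomp O B M).
Proof.
have H t t' u u' w w' v : t ~~ t' -> u ~~ u' ->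
    eqt w w' (t \c u) v -> eqt w w' (t' \c u') v.
  move=> Ht Hu K; have [T _] := eqt_typed K; apply: eqt_trans K; apply: eqt_sym.
  move/typedP: T => /= [[Wt Wu E] <- <-].
  apply: (eqt_comp (w2 := dom t)); apply: eqv_eqt => //; apply/typedP=> //.
move=> t t' Ht u u' Hu w w' v; split; apply: H=> //; by symmetry.
Qed.

#[global] Instance tbox_eqv : Proper (eqv ==> eqv ==> eqv) (@tbox O B M).
Proof.
have H t t' u u' w w' v : t ~~ t' -> u ~~ u' ->
    eqt w w' (t \x u) v -> eqt w w' (t' \x u') v.
  move=> Ht Hu K; have [T _] := eqt_typed K; apply: eqt_trans K; apply: eqt_sym.
  move/typedP: T => /= [[Wt Wu] <- <-].
  apply: eqt_box; apply: eqv_eqt => //; apply/typedP=> //.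
move=> t t' Ht u u' Hu w w' v; split; apply: H=> //; by symmetry.
Qed.

Lemma compA t u v : t \c (u \c v) ~~ t \c u \c v.
Proof.
apply: eqvI => /=; first by case=> [[]].
case=> /wt_typed T1 [/wt_typed T2 /wt_typed T3 E2] E1.
by rewrite E1 in T1; rewrite E2 in T2; apply: eqt_compA T1 T2 T3.
Qed.

Lemma comp1l t w : cod t = w -> tid w \c t ~~ t.
Proof.
move=> <-; apply: eqvI => /= [//|[_ W _]].
by apply: eqt_idl; apply/typedP.
Qed.

Lemma comp1r t w : dom t = w -> t \c tid w ~~ t.
Proof.
move=> <-; apply: eqvI => /= [//|[W _ _]].
by apply: eqt_idr; apply/typedP.
Qed.

Lemma boxA t u v : t \x (u \x v) ~~ t \x u \x v.
Proof.
apply: eqvI => /=; first by case=> [[]].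
by case=> W1 [W2 W3]; apply: eqt_boxA; apply/typedP.
Qed.

Lemma box1l t : tid [::] \x t ~~ t.
Proof. by apply: eqvI => //= [[_ W]]; apply: eqt_box1l; apply/typedP. Qed.

Lemma box1r t : t \x tid [::] ~~ t.
Proof.
by apply: eqvI => //= [[W _]]; rewrite !cats0; apply: eqt_box1r; apply/typedP.
Qed.

Lemma box_id w w' : tid w \x tid w' ~~ tid (w ++ w').
Proof. by apply: eqt_eqv; apply: eqt_box_id. Qed.

(** The conditions cannot be dropped: the right hand side is typed as soon as
    the concatenations of the two intermediate words agree, even if they are
    cut at different places. *)
Lemma box_comp t t' u u' : dom t = cod t' -> dom u = cod u' ->
  (t \c t') \x (u \c u') ~~ (t \x u) \c (t' \x u').
Proof.
move=> E1 E2; apply: eqvI => /=; first by case=> [[? ?] [? ?] _].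
case=> [[/wt_typed T1 /wt_typed T2 _] [/wt_typed T3 /wt_typed T4 _]].
by rewrite E1 in T1; rewrite E2 in T3; exact: eqt_box_comp T1 T2 T3 T4.
Qed.

Lemma swap_nat t u w w' v v' : typed w w' t -> typed v v' u ->
  tswap w' v' \c (t \x u) ~~ (u \x t) \c tswap w v.
Proof. by move=> Ht Hu; apply/eqt_eqv/eqt_swap_nat. Qed.

Lemma swapK w w' : tswap w' w \c tswap w w' ~~ tid (w ++ w').
Proof. exact/eqt_eqv/eqt_swapK. Qed.

Lemma swap_catr w1 w2 w3 : tswap w1 (w2 ++ w3) ~~
  (tid w2 \x tswap w1 w3) \c (tswap w1 w2 \x tid w3).
Proof. exact/eqt_eqv/eqt_swap_cat. Qed.

End Terms.

Section Localization.
Variables (O : obj_monoid) (B M : moncat O) (P : pointing B M).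

Lemma typed_loc w w' (t : tm B M) : typed P false w w' t -> typed P true w w' t.
Proof.
move=> /typedP[W <- <-]; apply: wt_typed.
by elim: t W => //= [t IHt u IHu []|t IHt u IHu []] *; split; auto.
Qed.

End Localization.

(** Solves the equations between endpoints which are the side conditions of the
    laws above, reading the endpoints of variables off the context. *)
Ltac endpoints :=
  rewrite ?cats0 //=;
  repeat match goal with
  | H : Defs.typed _ _ _ _ ?t |- context [dom ?t] => rewrite !(typed_dom H)
  | H : Defs.typed _ _ _ _ ?t |- context [cod _ ?t] => rewrite !(typed_cod H)
  end; rewrite ?cats0 -?catA ?cat_cons -?catA //=.

(** * Permutations of letters *)

Section Shuffles.
Variables (O : obj_monoid) (B M : moncat O) (P : pointing B M).
Variable S : option (sym_pointing P).
Variable l : bool.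
Implicit Types (phi psi : mor M) (s : mor B) (t : tm B M) (u v w : word M).

Local Notation "t \c u" := (tcomp t u).
Local Notation "t \x u" := (tbox t u).
Local Notation tid := (@tid O B M).
Local Notation tswap := (@tswap O B M).
Local Notation typed := (@typed O B M P l).
Local Notation "t ~~ u" := (eqv S l t u).

(** By the hexagon at two empty words this swap is idempotent; it is also
    invertible. *)
Lemma swap0r w : tswap w [::] ~~ tid w.
Proof.
have D := swap_catr S l w [::] [::]; rewrite box1l box1r /= in D.
have K := swapK S l w [::]; rewrite cats0 in K.
transitivity (tswap [::] w \c (tswap w [::] \c tswap w [::])).
  by rewrite compA K comp1l ?cats0.
by rewrite -D K.
Qed.

Lemma swap0l w : tswap [::] w ~~ tid w.
Proof.
have K := swapK S l [::] w; rewrite swap0r comp1l /= ?cats0 // in K.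
Qed.

(** Both sides have the same inverse, by the other hexagon. *)
Lemma swap_catl w1 w2 w3 : tswap (w1 ++ w2) w3 ~~
  (tswap w1 w3 \x tid w2) \c (tid w1 \x tswap w2 w3).
Proof.
set X := _ \c _.
have K : tswap w3 (w1 ++ w2) \c X ~~ tid (w1 ++ w2 ++ w3).
  rewrite swap_catr /X compA -(compA _ _ _ (tswap w3 w1 \x _)) -box_comp ?cats0 //.
  rewrite swapK comp1l // box_id comp1r; last by endpoints.
  by rewrite -box_comp // swapK comp1l // box_id.
rewrite -(comp1l S l (t := X) (w := w3 ++ w1 ++ w2)); last by endpoints.
rewrite -(swapK S l w3 (w1 ++ w2)) -compA K comp1r //; endpoints.
Qed.

Inductive shuffle : word M -> word M -> tm B M -> Prop :=
| sh_id w : shuffle w w (tid w)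
| sh_swap w1 w2 : shuffle (w1 ++ w2) (w2 ++ w1) (tswap w1 w2)
| sh_comp u v w t t' : shuffle v w t -> shuffle u v t' -> shuffle u w (t \c t')
| sh_box w1 w1' w2 w2' t t' : shuffle w1 w1' t -> shuffle w2 w2' t' ->
    shuffle (w1 ++ w2) (w1' ++ w2') (t \x t')
| sh_eqv v w t t' : shuffle v w t -> t ~~ t' -> shuffle v w t'.

Lemma typed_shuffle v w t : shuffle v w t -> typed v w t.
Proof.
elim=> *; [exact: ty_id | exact: ty_swap | apply: ty_comp; eassumption | |].
  exact: ty_box.
by apply: eqv_typed; eassumption.
Qed.

(** A new factor is added on the source side, since the arrows of an
    enumeration absorb transpositions there ([perm_tm_transposition]). *)
Inductive transpositions : word M -> word M -> tm B M -> Prop :=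
| tr_id w : transpositions w w (tid w)
| tr_step (a b : word M) (x y : mor M) w t : transpositions (a ++ x :: y :: b) w t ->
    transpositions (a ++ y :: x :: b) w
      (t \c (tid a \x tswap [:: y] [:: x] \x tid b)).

Lemma typed_tr v w t : transpositions v w t -> typed v w t.
Proof.
elim=> [*|a b x y w' t' _ IH]; first exact: ty_id.
apply: ty_comp IH _; have E c d : a ++ c :: d :: b = (a ++ [:: c; d]) ++ b.
  by rewrite -catA.
rewrite !E; apply: ty_box; last exact: ty_id.
by apply: ty_box; [exact: ty_id | exact: (ty_swap _ _ [:: y] [:: x])].
Qed.

Definition transposable v w t := exists2 t', transpositions v w t' & t ~~ t'.

Lemma transposable_comp u v w t t' :
  transposable v w t -> transposable u v t' -> transposable u w (t \c t').
Proof.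
move=> [x X E] [x' X' E'].
suff [y Y Ey] : exists2 y, transpositions u w y & x \c x' ~~ y.
  by exists y=> //; rewrite E E'.
elim: X' X {E E'} => [v'|a b p q v' z Z IH] X.
  by exists x=> //; rewrite comp1r ?(typed_dom (typed_tr X)).
have [y Y Ey] := IH X; exists (y \c (tid a \x tswap [:: q] [:: p] \x tid b)).
  exact: tr_step.
by rewrite compA Ey.
Qed.

Lemma transposable_ctx a b v w t :
  transposable v w t -> transposable (a ++ v ++ b) (a ++ w ++ b) (tid a \x t \x tid b).
Proof.
move=> [x X E].
suff [y Y Ey] : exists2 y, transpositions (a ++ v ++ b) (a ++ w ++ b) y &
   tid a \x x \x tid b ~~ y.
  by exists y=> //; rewrite E.
elim: X {E} => [v'|c d p q v' z Z [y Y Ey]].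
  by exists (tid (a ++ v' ++ b)); [exact: tr_id | rewrite !box_id catA].
exists (y \c (tid (a ++ c) \x tswap [:: q] [:: p] \x tid (d ++ b))).
  have E e f : a ++ (c ++ e :: f :: d) ++ b = (a ++ c) ++ e :: f :: d ++ b.
    by rewrite -!catA.
  by rewrite E; rewrite E in Y; apply: tr_step.
have Tz := typed_tr Z.
rewrite -Ey -!box_id -(comp1l S l (t := tid a) (w := a)) //.
rewrite -(comp1l S l (t := tid b) (w := b)) // !box_comp; endpoints.
by rewrite !comp1l // !boxA.
Qed.

Lemma transposable_eq v w v' w' t t' :
  v = v' -> w = w' -> t ~~ t' -> transposable v w t -> transposable v' w' t'.
Proof. by move=> -> -> E [x X Ex]; exists x=> //; rewrite -E. Qed.

(** A product of two arrows is the composite of the two arrows in context. *)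
Lemma transposable_box v v' w w' t t' : typed v w t -> typed v' w' t' ->
  transposable v w t -> transposable v' w' t' -> transposable (v ++ v') (w ++ w') (t \x t').
Proof.
move=> T T' St St'.
have E : (t \x tid w') \c (tid v \x t') ~~ t \x t'.
  by rewrite -box_comp ?comp1l ?comp1r; endpoints.
apply: transposable_eq E _ => //; apply: transposable_comp.
  by apply: (transposable_eq _ _ _ (transposable_ctx [::] w' St)); rewrite ?box1l.
apply: (transposable_eq _ _ _ (transposable_ctx v [::] St')); rewrite ?cats0 //.
by rewrite -boxA box1r.
Qed.

Lemma transposable_swap1 x w : transposable (x :: w) (w ++ [:: x]) (tswap [:: x] w).
Proof.
elim: w => [|y w IH].
  by exists (tid [:: x]); [exact: tr_id | rewrite swap0r].
apply: (transposable_eq (t := (tid [:: y] \x tswap [:: x] w) \c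
                         (tswap [:: x] [:: y] \x tid w))) => //.
  by rewrite -swap_catr.
apply: (transposable_comp (v := y :: x :: w)).
  apply: (transposable_eq _ _ _ (transposable_ctx [:: y] [::] IH)); rewrite ?cats0 //.
  by rewrite -boxA box1r.
exists (tid [:: y, x & w] \c (tid [::] \x tswap [:: x] [:: y] \x tid w)).
  exact: (@tr_step [::] w y x _ _ (tr_id _)).
by rewrite box1l comp1l.
Qed.

Lemma transposable_swap w w' : transposable (w ++ w') (w' ++ w) (tswap w w').
Proof.
elim: w => [|x w IH].
  by exists (tid w'); rewrite ?cats0; [exact: tr_id | rewrite swap0l].
apply: (transposable_eq (t := (tswap [:: x] w' \x tid w) \c
                         (tid [:: x] \x tswap w w'))) => //.
  by rewrite -swap_catl.
apply: (transposable_comp (v := x :: w' ++ w)).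
  apply: (transposable_eq _ _ _ (transposable_ctx [::] w (transposable_swap1 x w'))) => //.
    by rewrite /= -catA.
  by rewrite box1l.
apply: (transposable_eq _ _ _ (transposable_ctx [:: x] [::] IH)); rewrite ?cats0 //.
by rewrite -boxA box1r.
Qed.

Lemma shuffle_transpositions v w t : shuffle v w t -> transposable v w t.
Proof.
elim=> {v w t} [w|w w'|u v w t t' _ IH _ IH'|v v' w w' t t' T IH T' IH'|].
- by exists (tid w); [exact: tr_id | reflexivity].
- exact: transposable_swap.
- exact: transposable_comp IH IH'.
- exact: transposable_box (typed_shuffle T) (typed_shuffle T') IH IH'.
- by move=> v w t t' _ St E; apply: transposable_eq E St.
Qed.

End Shuffles.

(** * Coherence of the symmetry *)

Section Enumerations.
Variables (O : obj_monoid) (B M : moncat O) (P : pointing B M).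
Variable S : option (sym_pointing P).
Variable l : bool.
Variables (T : eqType) (f : T -> mor M).
Implicit Types (phi psi : mor M) (s : mor B) (t : tm B M) (u v w : word M).

Local Notation "t \c u" := (tcomp t u).
Local Notation "t \x u" := (tbox t u).
Local Notation tid := (@tid O B M).
Local Notation id1 phi := (tid [:: phi]).
Local Notation tswap := (@tswap O B M).
Local Notation typed := (@typed O B M P l).
Local Notation "t ~~ u" := (eqv S l t u).
Local Notation perm_tm := (@perm_tm O B M T f).
Implicit Types (e r : seq T) (x y z : T).

(** The letter z is found right after c because it does not occur in c; the
    enumerations considered below have no repetitions. *)
Lemma perm_tm_cons c g z r : z \notin c ->
  perm_tm (c ++ z :: g) (z :: r) =
  (id1 (f z) \x perm_tm (c ++ g) r) \c
  (tswap (map f c) [:: f z] \x tid (map f g)).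
Proof.
move=> zc /=; rewrite index_cat (negPf zc) /= eqxx addn0 take_size_cat //.
have -> : rem z (c ++ z :: g) = c ++ g.
  elim: c zc => /= [|d c IH]; first by rewrite eqxx.
  by rewrite inE negb_or eq_sym => /andP[/negPf-> /IH->].
by rewrite -cat_rcons drop_size_cat ?size_rcons.
Qed.

Lemma perm_mid c g z r : perm_eq (c ++ z :: g) (z :: r) = perm_eq (c ++ g) r.
Proof. by rewrite -cat1s perm_catCA /= perm_cons. Qed.

Lemma typed_perm_tm e r : uniq r -> perm_eq e r ->
  typed (map f e) (map f r) (perm_tm e r).
Proof.
elim: r e => [|z r IH] e Ur E.
  by move/perm_nilP: E => ->; apply: ty_id.
have Ue : uniq e by rewrite (perm_uniq E).
have ze : z \in e by rewrite (perm_mem E) mem_head.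
case/splitPr: ze Ue E => [c g]; rewrite uniq_catC cat_cons cons_uniq => /andP[].
rewrite mem_cat negb_or => /andP[_ zc] _.
rewrite perm_mid => E; rewrite perm_tm_cons //.
case/andP: Ur => _ Ur.
apply: ty_comp (ty_box (ty_id _ _ [:: f z]) (IH _ Ur E)) _.
have -> : map f (c ++ z :: g) = (map f c ++ [:: f z]) ++ map f g.
  by rewrite map_cat -catA.
rewrite map_cat catA.
apply: ty_box (ty_swap _ _ _ _) (ty_id _ _ _).
Qed.

Lemma perm_tm_id r : uniq r -> perm_tm r r ~~ tid (map f r).
Proof.
elim: r => [|z r IH] /=; first by [].
case/andP=> zr Ur; rewrite eqxx /= ?take0 ?drop0 IH // swap0l !box_id comp1l //.
Qed.

Lemma swap_slide u v w w' t : typed w w' t ->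
  (tswap u v \x tid w') \c (tid (u ++ v) \x t) ~~
  (tid (v ++ u) \x t) \c (tswap u v \x tid w).
Proof. by move=> Tt; rewrite -!box_comp ?comp1l ?comp1r; endpoints. Qed.

(** Both arrows first bring the first letter z of r to the front. If z is not
    one of x and y, then the transposition slides past this move; if it is,
    then the hexagon merges the transposition with the move or cancels it
    against a part of the move. *)
Lemma perm_tm_transposition a b x y r :
  uniq r -> perm_eq (a ++ x :: y :: b) r ->
  perm_tm (a ++ x :: y :: b) r \c
    (tid (map f a) \x tswap [:: f y] [:: f x] \x tid (map f b)) ~~
  perm_tm (a ++ y :: x :: b) r.
Proof.
elim: r a b => [|z r IH] a b.
  by move=> _ /perm_nilP; case: a.
move=> Ur E; have Ue : uniq (a ++ x :: y :: b) by rewrite (perm_uniq E).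
have : z \in a ++ x :: y :: b by rewrite (perm_mem E) mem_head.
case/andP: Ur => _ Ur.
rewrite mem_cat !inE => /orP[|/or3P[/eqP zx|/eqP zy|]].
(* z lies in a: the transposition takes place on the right of the move. *)
- move=> za; case/splitPr: za Ue E => c g.
  rewrite -!catA !cat_cons uniq_catC cat_cons cons_uniq perm_mid => /andP[+ _] E.
  rewrite mem_cat negb_or => /andP[_ zc].
  rewrite !perm_tm_cons //.
  set X := tid (map f g) \x (tswap [:: f y] [:: f x] \x tid (map f b)).
  have TX : typed (map f (g ++ y :: x :: b)) (map f (g ++ x :: y :: b)) X.
    by apply/typedP; rewrite /= !map_cat.
  rewrite (_ : map f (c ++ z :: g) = (map f c ++ [:: f z]) ++ map f g);
    last by rewrite map_cat -catA.
  rewrite -box_id -!boxA -/X.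
  rewrite -compA (swap_slide _ _ TX) compA -box_id.
  rewrite -(boxA _ _ (id1 _)) -box_comp //; last first.
    by rewrite (typed_dom (typed_perm_tm Ur E)) [RHS]/= !map_cat.
  rewrite comp1l // [in X in _ ~~ X]catA -IH -?catA // !map_cat.
  by rewrite -!box_id /X !boxA.
(* z = x: the transposition is the first step of the move of x past a and y. *)
- subst z; move: Ue E; rewrite -[y :: x :: b]cat1s (catA a).
  rewrite uniq_catC cat_cons cons_uniq mem_cat negb_or perm_mid.
  move=> /andP[/andP[]].
  rewrite inE negb_or => /andP[xy xb] xa _ E.
  have x_ay : x \notin a ++ [:: y] by rewrite mem_cat inE negb_or xa.
  rewrite !perm_tm_cons // -catA -compA !map_cat swap_catl.
  rewrite (_ : map f (y :: b) = [:: f y] ++ map f b) // -box_id boxA.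
  by rewrite -box_comp ?comp1l /=; endpoints.
(* z = y: the move of y past a and x begins by undoing the transposition. *)
- subst z; move: Ue E; rewrite -(cat1s x (y :: b)) (catA a).
  rewrite uniq_catC cat_cons cons_uniq mem_cat negb_or perm_mid.
  move=> /andP[/andP[]].
  rewrite mem_cat inE negb_or => yb /andP[ya xy] _ E.
  rewrite perm_tm_cons ?mem_cat ?inE ?negb_or ?ya //.
  rewrite [in X in _ ~~ X]perm_tm_cons //.
  rewrite -catA -compA map_cat swap_catl -box_comp // -[map f [:: x]]/[:: f x].
  rewrite -compA -(box_comp S l (t := tid (map f a))) // swapK comp1l // box_id.
  rewrite comp1r; last by endpoints.
  by rewrite (_ : map f (x :: b) = [:: f x] ++ map f b) // -box_id boxA !comp1l.
(* z lies in b: it moves past both x and y, by naturality. *)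
- move=> zb; case/splitPr: zb Ue E => c g.
  have Ez p q : a ++ p :: q :: c ++ z :: g = (a ++ p :: q :: c) ++ z :: g.
    by rewrite -catA.
  rewrite !(Ez x y) (Ez y x) perm_mid uniq_catC cat_cons cons_uniq.
  move=> /andP[+ _] E; rewrite mem_cat negb_or => /andP[_ zc].
  have zc' : z \notin a ++ y :: x :: c.
    apply: contra zc; rewrite !mem_cat !inE.
    by case/or4P => ->; rewrite ?orbT.
  have Eg p q : (a ++ p :: q :: c) ++ g = a ++ p :: q :: c ++ g by rewrite -catA.
  rewrite Eg in E; rewrite !perm_tm_cons // (Eg x y) (Eg y x) -IH //.
  set X := tid (map f a) \x tswap [:: f y] [:: f x] \x tid (map f c).
  have TX : typed (map f (a ++ y :: x :: c)) (map f (a ++ x :: y :: c)) X.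
    by apply/typedP; rewrite /= !map_cat -!catA.
  rewrite (_ : map f (c ++ z :: g) = map f c ++ [:: f z] ++ map f g);
    last by rewrite map_cat.
  rewrite (map_cat _ c g) -!box_id !boxA -/X; clearbody X.
  rewrite -compA -box_comp //; last by rewrite /= (typed_cod TX).
  rewrite (swap_nat S TX (ty_id _ _ _)).
  rewrite box_comp ?compA; [|by rewrite /= (typed_dom TX)|by []].
  rewrite -(boxA _ _ (id1 _)) -box_comp ?comp1l //.
  by rewrite (typed_dom (typed_perm_tm Ur E)) /= (typed_cod TX) -map_cat Eg.
Qed.

(** Coherence for the symmetry: since r has no repetitions, a shuffle onto its
    labels is determined by the enumeration of r that it comes from, even if
    some labels are equal. *)
Lemma shuffle_perm_tm r w t : uniq r -> shuffle S l w (map f r) t ->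
  exists2 e, perm_eq e r & w = map f e /\ t ~~ perm_tm e r.
Proof.
move=> Ur /shuffle_transpositions[t' + Et].
suff: forall v, transpositions w v t' -> v = map f r ->
    exists2 e, perm_eq e r & w = map f e /\ t' ~~ perm_tm e r.
  by move=> H /H[//|e Ee [-> Et']]; exists e=> //; rewrite Et.
move=> v; elim=> {w v t t' Et} [w|a b x y w t Ht IH] Ew.
  by exists r=> //; rewrite Ew perm_tm_id.
have [e Ee [We Et]] := IH Ew.
have Ea : a = map f (take (size a) e) by rewrite map_take -We take_size_cat.
have : x :: y :: b = map f (drop (size a) e) by rewrite map_drop -We drop_size_cat.
case def_b: (drop (size a) e) => [|ex [|ey eb]] //= [-> -> ->].
have def_e : e = take (size a) e ++ ex :: ey :: eb by rewrite -def_b cat_take_drop.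
move: Ea def_e; move: (take _ e) => ea -> def_e; exists (ea ++ ey :: ex :: eb).
  apply: perm_trans Ee; rewrite def_e perm_cat2l.
  by apply/permPl; apply: (perm_catCA [:: ey] [:: ex]).
split; first by rewrite map_cat.
rewrite Et def_e perm_tm_transposition // -def_e //.
Qed.
End Enumerations.

(** * Products of arrows, one for each letter *)

Section Families.
Variables (O : obj_monoid) (B M : moncat O) (P : pointing B M).
Variable S : option (sym_pointing P).
Variable l : bool.
Implicit Types (phi psi : mor M) (s t : tm B M) (u v w : word M).

Local Notation "t \c u" := (tcomp t u).
Local Notation "t \x u" := (tbox t u).
Local Notation tid := (@tid O B M).
Local Notation tswap := (@tswap O B M).
Local Notation typed := (@typed O B M P l).
Local Notation "t ~~ u" := (eqv S l t u).
Local Notation shuffle := (shuffle S l).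

(** The arrows of the family L have one letter at one end; L phi u t is used
    both for arrows u -> phi (diagrams) and for arrows phi -> u (splittings),
    and in both cases the first word of [letterwise] is the word of the
    letters. *)
Section Letterwise.
Variable L : mor M -> word M -> tm B M -> Prop.

Inductive letterwise : word M -> word M -> tm B M -> Prop :=
| lw_nil : letterwise [::] [::] (tid [::])
| lw_cons phi u t w v t' : L phi u t -> letterwise w v t' ->
    letterwise (phi :: w) (u ++ v) (t \x t')
| lw_eqv w v t t' : letterwise w v t -> t ~~ t' -> letterwise w v t'.

Lemma lw_letter phi u t : L phi u t -> letterwise [:: phi] u t.
Proof.
move=> Lt; rewrite -[u]cats0; apply: lw_eqv (lw_cons Lt lw_nil) _.
exact: box1r.
Qed.

Lemma lw_box w v t w' v' t' : letterwise w v t -> letterwise w' v' t' ->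
  letterwise (w ++ w') (v ++ v') (t \x t').
Proof.
move=> H H'; elim: H => {w v t} [|phi u t w v t1 Lt _ IH|w v t t1 _ IH E].
- by apply: lw_eqv H' _; rewrite box1l.
- by rewrite -catA; apply: lw_eqv (lw_cons Lt IH) _; rewrite boxA.
- by apply: lw_eqv IH _; rewrite E.
Qed.

Lemma lw_cat w1 w2 v t : letterwise (w1 ++ w2) v t -> exists v1 v2 t1 t2,
  [/\ v = v1 ++ v2, letterwise w1 v1 t1, letterwise w2 v2 t2 & t ~~ t1 \x t2].
Proof.
move def_w: (w1 ++ w2) => w H; elim: H w1 w2 def_w => {w v t}.
- move=> [|? ?] [|? ?] // _; exists [::], [::], (tid [::]), (tid [::]).
  by split=> //; rewrite ?box1l //; apply: lw_nil.
- move=> phi u t w v t' Lt Lt' IH [|psi w1] w2 /=.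
    move=> ->; exists [::], (u ++ v), (tid [::]), (t \x t').
    by split; rewrite ?box1l //; [apply: lw_nil | apply: lw_cons].
  case=> -> /IH[v1 [v2 [t1 [t2 [-> L1 L2 E]]]]].
  exists (u ++ v1), v2, (t \x t1), t2; split=> //; first exact: catA.
    exact: lw_cons.
  by rewrite E boxA.
- move=> w v t t' _ IH E w1 w2 /IH[v1 [v2 [t1 [t2 [-> L1 L2 E']]]]].
  by exists v1, v2, t1, t2; split=> //; rewrite -E.
Qed.

Lemma lw_nilV v t : letterwise [::] v t -> v = [::] /\ t ~~ tid [::].
Proof.
move def_w: [::] => w H; elim: H def_w => {w v t} // w v t t' _ IH E.
by move=> /IH[-> E1]; rewrite -E.
Qed.

Lemma lw_letterV phi v t : letterwise [:: phi] v t ->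
  exists2 t', L phi v t' & t ~~ t'.
Proof.
move def_w: [:: phi] => w H; elim: H def_w => {w v t} //.
  move=> psi u t w v t' Lt Lt' _ [-> def_w]; subst w.
  by have [-> E] := lw_nilV Lt'; exists t; rewrite ?cats0 // E box1r.
by move=> w v t t' _ IH E /IH[t1 L1 E1]; exists t1; rewrite -?E.
Qed.

End Letterwise.

(** Naturality of the symmetry for families of arrows u -> phi: permuting the
    targets amounts to permuting the blocks of the source. *)
Section Naturality.
Variable L : mor M -> word M -> tm B M -> Prop.
Hypothesis L_typed : forall phi u t, L phi u t -> typed u [:: phi] t.

Lemma typed_lw w v t : letterwise L w v t -> typed v w t.
Proof.
elim=> {w v t} [|phi u t w v t' /L_typed T _ T'|w v t t' _ T E].
- exact: ty_id.
- exact: (ty_box T T').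
- exact: eqv_typed E T.
Qed.

Lemma shuffle_lw w w' v s t : shuffle w w' s -> letterwise L w v t ->
  exists v' s' t', [/\ shuffle v v' s', letterwise L w' v' t' & s \c t ~~ t' \c s'].
Proof.
move=> H; elim: H v t => {w w' s}.
- move=> w v t Lt; exists v, (tid v), t; split=> //; first exact: sh_id.
  by have T := typed_lw Lt; rewrite comp1l ?comp1r; endpoints.
- move=> w w' v t /lw_cat[v1 [v2 [t1 [t2 [-> L1 L2 E]]]]].
  exists (v2 ++ v1), (tswap v1 v2), (t2 \x t1); split; first exact: sh_swap.
    exact: lw_box.
  by rewrite E (swap_nat S (typed_lw L1) (typed_lw L2)).
- move=> w1 w2 w3 s s' _ IH _ IH' v t /IH'[v2 [s2 [t2 [Hs2 L2 E2]]]].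
  have [v3 [s3 [t3 [Hs3 L3 E3]]]] := IH _ _ L2.
  exists v3, (s3 \c s2), t3; split=> //; first exact: sh_comp Hs3 Hs2.
  by rewrite -compA E2 compA E3 compA.
- move=> w1 w1' w2 w2' s s' /typed_shuffle Ts IH /typed_shuffle Ts' IH' v t.
  move=> /lw_cat[v1 [v2 [t1 [t2 [-> L1 L2 E]]]]].
  have [v1' [s1 [t1' [Hs1 L1' E1]]]] := IH _ _ L1.
  have [v2' [s2 [t2' [Hs2 L2' E2]]]] := IH' _ _ L2.
  exists (v1' ++ v2'), (s1 \x s2), (t1' \x t2'); split; first exact: sh_box.
    exact: lw_box.
  have [T1 T2] := (typed_lw L1, typed_lw L2).
  have [T1' T2'] := (typed_lw L1', typed_lw L2').
  have [Us1 Us2] := (typed_shuffle Hs1, typed_shuffle Hs2).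
  by rewrite E -box_comp ?E1 ?E2 ?box_comp; endpoints.
- move=> w w' s s' _ IH E v t /IH[v' [s2 [t' [? ? E2]]]].
  by exists v', s2, t'; split=> //; rewrite -E.
Qed.
End Naturality.

(** The same for families of arrows phi -> u. *)
Section NaturalityV.
Variable L : mor M -> word M -> tm B M -> Prop.
Hypothesis L_typed : forall phi u t, L phi u t -> typed [:: phi] u t.

Lemma typed_lwV w v t : letterwise L w v t -> typed w v t.
Proof.
elim=> {w v t} [|phi u t w v t' /L_typed T _ T'|w v t t' _ T E].
- exact: ty_id.
- exact: (ty_box T T').
- exact: eqv_typed E T.
Qed.

Lemma lw_shuffle w w' v s t : shuffle w' w s -> letterwise L w v t ->
  exists v' s' t', [/\ shuffle v' v s', letterwise L w' v' t' & t \c s ~~ s' \c t'].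
Proof.
move=> H; elim: H v t => {w w' s}.
- move=> w v t Lt; exists v, (tid v), t; split=> //; first exact: sh_id.
  by have T := typed_lwV Lt; rewrite comp1l ?comp1r; endpoints.
- move=> w w' v t /lw_cat[v1 [v2 [t1 [t2 [-> L1 L2 E]]]]].
  exists (v2 ++ v1), (tswap v2 v1), (t2 \x t1); split; first exact: sh_swap.
    exact: lw_box.
  by rewrite E (swap_nat S (typed_lwV L2) (typed_lwV L1)).
- move=> w1 w2 w3 s s' _ IH _ IH' v t /IH[v2 [s2 [t2 [Hs2 L2 E2]]]].
  have [v3 [s3 [t3 [Hs3 L3 E3]]]] := IH' _ _ L2.
  exists v3, (s2 \c s3), t3; split=> //; first exact: sh_comp Hs2 Hs3.
  by rewrite compA E2 -compA E3 compA.
- move=> w1 w1' w2 w2' s s' /typed_shuffle Ts IH /typed_shuffle Ts' IH' v t.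
  move=> /lw_cat[v1 [v2 [t1 [t2 [-> L1 L2 E]]]]].
  have [v1' [s1 [t1' [Hs1 L1' E1]]]] := IH _ _ L1.
  have [v2' [s2 [t2' [Hs2 L2' E2]]]] := IH' _ _ L2.
  exists (v1' ++ v2'), (s1 \x s2), (t1' \x t2'); split; first exact: sh_box.
    exact: lw_box.
  have [T1 T2] := (typed_lwV L1, typed_lwV L2).
  have [T1' T2'] := (typed_lwV L1', typed_lwV L2').
  have [Us1 Us2] := (typed_shuffle Hs1, typed_shuffle Hs2).
  by rewrite E -box_comp ?E1 ?E2 ?box_comp; endpoints.
- move=> w w' s s' _ IH E v t /IH[v' [s2 [t' [? ? E2]]]].
  by exists v', s2, t'; split=> //; rewrite -E.
Qed.
End NaturalityV.
End Families.

(** * Coherence of the product *)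

Section Mu.
Variables (O : obj_monoid) (B M : moncat O) (P : pointing B M).
Variable S : option (sym_pointing P).
Variable l : bool.
Implicit Types (phi psi : mor M) (s t : tm B M) (u v w : word M).

Local Notation "t \c u" := (tcomp t u).
Local Notation "t \x u" := (tbox t u).
Local Notation tid := (@tid O B M).
Local Notation id1 phi := (tid [:: phi]).
Local Notation tmu := (@tmu O B M).
Local Notation tmu1 := (@tmu1 O B M).
Local Notation mu_iter := (@mu_iter O B M).
Local Notation typed := (@typed O B M P l).
Local Notation "t ~~ u" := (eqv S l t u).

Lemma big_ten_cat w v : big_ten (w ++ v) = ten (big_ten w) (big_ten v).
Proof. by elim: w => [|phi w IH] /=; rewrite ?ten1l // IH tenA. Qed.

Lemma big_ten1 phi : big_ten [:: phi] = phi.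
Proof. exact: ten1r. Qed.

Lemma typed_mu_iter w : typed w [:: big_ten w] (mu_iter w).
Proof.
elim: w => [|phi [|psi w] IH]; first exact: ty_mu1.
  by rewrite big_ten1; apply: ty_id.
apply: (ty_comp (w2 := [:: phi; big_ten (psi :: w)])); first exact: ty_mu.
exact: (ty_box (ty_id _ _ [:: phi]) IH).
Qed.

Lemma mu_iter_cons phi w :
  mu_iter (phi :: w) ~~ tmu phi (big_ten w) \c (id1 phi \x mu_iter w).
Proof.
by case: w => [|psi w] //; symmetry; apply: eqt_eqv; apply: eqt_mu1r.
Qed.

Lemma mu1l phi : tmu (idm (oneO O)) phi \c (tmu1 \x id1 phi) ~~ id1 phi.
Proof. exact/eqt_eqv/eqt_mu1l. Qed.

Lemma muA phi1 phi2 phi3 :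
  tmu (ten phi1 phi2) phi3 \c (tmu phi1 phi2 \x id1 phi3) ~~
  tmu phi1 (ten phi2 phi3) \c (id1 phi1 \x tmu phi2 phi3).
Proof. exact/eqt_eqv/eqt_muA. Qed.

Lemma mu_iter_cat w v : mu_iter (w ++ v) ~~
  tmu (big_ten w) (big_ten v) \c (mu_iter w \x mu_iter v).
Proof.
have Tv := typed_mu_iter v.
elim: w => [|phi w IH].
  have E : tmu1 \x mu_iter v ~~ (tmu1 \x id1 (big_ten v)) \c (tid [::] \x mu_iter v).
    by rewrite -box_comp ?comp1l ?comp1r; endpoints.
  by rewrite /= E compA mu1l box1l comp1l; endpoints.
rewrite cat_cons !mu_iter_cons IH big_ten_cat.
have Tw := typed_mu_iter w.
rewrite -{1}(comp1l S l (t := id1 phi) (w := [:: phi])) // box_comp //; last by endpoints.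
rewrite compA -muA -compA boxA /=.
by rewrite -(box_comp S l (t := tmu _ _)) ?comp1l; endpoints.
Qed.

(** Coherence for mu: by associativity and unitality all the ways to multiply
    the letters of a word give the same arrow. *)
Lemma mu_arrow_iter t : mu_arrow t -> forall u w, typed u w t ->
  big_ten u = big_ten w /\ mu_iter w \c t ~~ mu_iter u.
Proof.
elim=> {t}.
- move=> w u v /typedP[_ /= <- <-]; split=> //.
  by rewrite comp1r ?(typed_dom (typed_mu_iter w)).
- move=> phi psi u v /typedP[_ /= <- <-]; split; first by rewrite /= !ten1r.
  by rewrite /= ten1r comp1l // box_id comp1r.
- by move=> u v /typedP[_ /= <- <-]; rewrite big_ten1 /= comp1l.
- move=> t t' _ IH _ IH' u w /typedP[/= [W W' E] <- <-].
  have [-> E2] := IH' _ _ (wt_typed W'); rewrite compA -E.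
  have [-> E1] := IH _ _ (wt_typed W); split=> //.
  by rewrite E1 E E2.
- move=> t t' _ IH _ IH' u w /typedP[/= [W W'] <- <-].
  have [E1 E2] := IH _ _ (wt_typed W); have [E1' E2'] := IH' _ _ (wt_typed W').
  rewrite !big_ten_cat E1 E1'; split=> //.
  rewrite !mu_iter_cat -compA -box_comp ?E2 ?E2' ?E1 ?E1' //.
  + by rewrite (typed_dom (typed_mu_iter _)).
  + by rewrite (typed_dom (typed_mu_iter _)).
Qed.

Lemma mu_arrow_mu_iter w : mu_arrow (mu_iter w).
Proof.
elim: w => [|phi [|psi w] IH] /=; [exact: mua_mu1 | exact: mua_id |].
apply: mua_comp; first exact: mua_mu.
by apply: mua_box; first exact: mua_id.
Qed.

(** Condition (2) of localizability compares the first letters a and b of the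
    two words: one is the product of the other with some chi, which is put back
    in front of the remaining letters of its word. Both words have to be non
    empty, because only the empty word itself has a mu-arrow to the empty
    word. *)
Lemma common_refinement w1 w2 : localizable2 M ->
  w1 <> [::] -> w2 <> [::] -> big_ten w1 = big_ten w2 ->
  exists u (m1 m2 : tm B M),
    [/\ mu_arrow m1, mu_arrow m2, typed u w1 m1 & typed u w2 m2].
Proof.
move=> loc2; have [n] := ubnP (size w1 + size w2).
elim: n w1 w2 => // n IH [|a w1] [|b w2] // len _ _ E.
(* A word with one letter is refined by every word with the same product. *)
case: w1 E len => [|a' w1] E len.
  exists (b :: w2), (mu_iter (b :: w2)), (tid (b :: w2)); split.
  - exact: mu_arrow_mu_iter.
  - exact: mua_id.
  - by rewrite -(big_ten1 a) E; apply: typed_mu_iter.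
  - exact: ty_id.
case: w2 E len => [|b' w2] E len.
  exists [:: a, a' & w1], (tid [:: a, a' & w1]), (mu_iter [:: a, a' & w1]); split.
  - exact: mua_id.
  - exact: mu_arrow_mu_iter.
  - exact: ty_id.
  - by rewrite -(big_ten1 b) -E; apply: typed_mu_iter.
move: E => /loc2[chi [[def_a E]|[def_b E]]].
  have [|//|//|u [m1 [m2 [A1 A2 T1 T2]]]] :=
    IH (chi :: a' :: w1) (b' :: w2) _ _ _ (esym E).
    by move: len; rewrite /= !addSn !addnS !ltnS.
  exists (b :: u), ((tmu b chi \x tid (a' :: w1)) \c (id1 b \x m1)), (id1 b \x m2).
  split.
  - by apply: mua_comp; apply: mua_box; by [|apply: mua_id|apply: mua_mu].
  - by apply: mua_box => //; apply: mua_id.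
  - rewrite def_a; apply: (ty_comp (w2 := [:: b, chi, a' & w1])).
      exact: (ty_box (ty_mu _ _ b chi) (ty_id _ _ (a' :: w1))).
    exact: (ty_box (ty_id _ _ [:: b]) T1).
  - exact: (ty_box (ty_id _ _ [:: b]) T2).
have [|//|//|u [m1 [m2 [A1 A2 T1 T2]]]] :=
  IH (a' :: w1) (chi :: b' :: w2) _ _ _ E.
  by move: len; rewrite /= !addSn !addnS !ltnS.
exists (a :: u), (id1 a \x m1), ((tmu a chi \x tid (b' :: w2)) \c (id1 a \x m2)).
split.
- by apply: mua_box => //; apply: mua_id.
- by apply: mua_comp; apply: mua_box; by [|apply: mua_id|apply: mua_mu].
- exact: (ty_box (ty_id _ _ [:: a]) T1).
- rewrite def_b; apply: (ty_comp (w2 := [:: a, chi, b' & w2])).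
    exact: (ty_box (ty_mu _ _ a chi) (ty_id _ _ (b' :: w2))).
  exact: (ty_box (ty_id _ _ [:: a]) T2).
Qed.
End Mu.

(** * Equality of roofs *)

Section MuInverse.
Variables (O : obj_monoid) (B M : moncat O) (P : pointing B M).
Variable S : option (sym_pointing P).
Implicit Types (phi psi : mor M) (s t : tm B M) (u v w : word M).

Local Notation "t \c u" := (tcomp t u).
Local Notation "t \x u" := (tbox t u).
Local Notation tid := (@tid O B M).
Local Notation id1 phi := (tid [:: phi]).
Local Notation tmu := (@tmu O B M).
Local Notation tmuV := (@tmuV O B M).
Local Notation mu_iter := (@mu_iter O B M).
Local Notation muV_iter := (@muV_iter O B M).
Local Notation typed := (@typed O B M P true).
Local Notation "t ~~ u" := (eqv S true t u).

Lemma muK phi psi : tmuV phi psi \c tmu phi psi ~~ tid [:: phi; psi].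
Proof. exact/eqt_eqv/eqt_muK. Qed.

Lemma muVK phi psi : tmu phi psi \c tmuV phi psi ~~ id1 (ten phi psi).
Proof. exact/eqt_eqv/eqt_muVK. Qed.

Lemma typed_muV_iter w : typed [:: big_ten w] w (muV_iter w).
Proof.
elim: w => [|phi [|psi w] IH]; first exact: ty_mu1V.
  by rewrite big_ten1; apply: ty_id.
apply: (ty_comp (w2 := [:: phi; big_ten (psi :: w)])); last exact: ty_muV.
exact: (ty_box (ty_id _ _ [:: phi]) IH).
Qed.

Lemma muV_iter_cons phi psi w : muV_iter [:: phi, psi & w] =
  (id1 phi \x muV_iter (psi :: w)) \c tmuV phi (big_ten (psi :: w)).
Proof. by []. Qed.

Lemma mu_iterK w : muV_iter w \c mu_iter w ~~ tid w.
Proof.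
elim: w => [|phi [|psi w] IH]; first exact/eqt_eqv/eqt_mu1K.
  by rewrite /= comp1l.
have [T T'] := (typed_mu_iter P true (psi :: w), typed_muV_iter (psi :: w)).
rewrite mu_iter_cons muV_iter_cons.
rewrite -compA (compA _ _ (tmuV _ _)) muK comp1l; last by endpoints.
by rewrite -box_comp ?IH ?comp1l ?box_id; endpoints.
Qed.

Lemma muV_iterK w : mu_iter w \c muV_iter w ~~ id1 (big_ten w).
Proof.
elim: w => [|phi [|psi w] IH]; first exact/eqt_eqv/eqt_mu1VK.
  by rewrite big_ten1 /= comp1l.
have [T T'] := (typed_mu_iter P true (psi :: w), typed_muV_iter (psi :: w)).
rewrite mu_iter_cons muV_iter_cons.
rewrite -compA (compA _ _ (_ \x _)) -box_comp ?IH ?comp1l ?box_id; endpoints.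
by rewrite comp1l ?muVK.
Qed.

Lemma muV_iter_cat w v : muV_iter (w ++ v) ~~
  (muV_iter w \x muV_iter v) \c tmuV (big_ten w) (big_ten v).
Proof.
have [T T'] := (typed_muV_iter (w ++ v), typed_mu_iter P true w).
have [Tw Tv] := (typed_muV_iter w, typed_muV_iter v).
set X := _ \c tmuV _ _; have DX : cod P X = w ++ v by rewrite /X; endpoints.
rewrite -(comp1l S true DX) -mu_iterK mu_iter_cat /X -!compA.
have T2 := typed_mu_iter P true v.
rewrite (compA _ _ (_ \x _)) -box_comp; [|by endpoints..].
by rewrite !muV_iterK box_id comp1l // muVK -big_ten_cat comp1r; endpoints.
Qed.

(** By coherence, composing with a mu-arrow into w1 turns the roof of Gam1 into
    one with another decomposition, and does not change the morphism that it
    represents; so roofs may be compared on a common refinement. *)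
Lemma roof_morP phi psi w1 Gam1 w2 Gam2 : localizable2 M ->
  roof P phi psi w1 Gam1 -> roof P phi psi w2 Gam2 ->
  redE S phi psi (roof_mor w1 Gam1) (roof_mor w2 Gam2) <->
  roof_equiv S phi psi w1 Gam1 w2 Gam2.
Proof.
move=> loc2 [n1 E1 /typed_loc T1] [n2 E2 /typed_loc T2].
have T1' := typed_muV_iter w1; have T2' := typed_muV_iter w2.
have T1'' := typed_mu_iter P true w1; have T2'' := typed_mu_iter P true w2.
split.
  move=> E12; have E := eqt_eqv E12; rewrite /roof_mor in E.
  have [|u [m1 [m2 [A1 A2 U1 U2]]]] := common_refinement P false loc2 n1 n2.
    by rewrite -E1 -E2.
  exists u, m1, m2; split=> //.
    have [F1 G1] := mu_arrow_iter S A1 U1; have [F2 G2] := mu_arrow_iter S A2 U2.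
    rewrite E1 -F1; apply: eqv_eqt; first by rewrite G1 G2.
    by rewrite F1; apply: ty_comp U1; apply: typed_mu_iter.
  have [V1 V2] := (typed_loc U1, typed_loc U2).
  have [F1 G1] := mu_arrow_iter S A1 V1; have [F2 G2] := mu_arrow_iter S A2 V2.
  apply: eqv_eqt; last exact: ty_comp T1 V1.
  rewrite -(comp1l S _ (typed_cod V1)) -(comp1l S _ (typed_cod V2)).
  by rewrite -!mu_iterK -!compA G1 G2 !compA E.
case=> u [m1 [m2 [[A1 A2] [/typed_loc U1 /typed_loc U2] _ E12]]].
have E := eqt_eqv E12.
have [F1 G1] := mu_arrow_iter S A1 U1; have [F2 G2] := mu_arrow_iter S A2 U2.
have Tu := typed_muV_iter u.
have H w m (T : typed [:: big_ten w] w (muV_iter w)) : mu_iter w \c m ~~ mu_iter u ->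
    typed u w m -> big_ten u = big_ten w -> muV_iter w ~~ m \c muV_iter u.
  move=> G U F; rewrite -[m in X in _ ~~ X](comp1l S _ (typed_cod U)).
  rewrite -mu_iterK -(compA _ _ _ _ m) G -compA muV_iterK comp1r //; endpoints.
  by rewrite F.
apply: eqv_eqt; last by rewrite E1; apply: ty_comp T1 T1'.
by rewrite /roof_mor (H _ _ T1' G1 U1 F1) (H _ _ T2' G2 U2 F2) !compA E.
Qed.
End MuInverse.

(** * Splitting diagrams *)

Section Diagrammatic.
Variables (O : obj_monoid) (B M : moncat O) (P : pointing B M).
Variable S : option (sym_pointing P).
Implicit Types (phi psi : mor M) (t d r : tm B M) (u v w : word M).

Local Notation "t \c u" := (tcomp t u).
Local Notation "t \x u" := (tbox t u).
Local Notation tid := (@tid O B M).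
Local Notation id1 phi := (tid [:: phi]).
Local Notation tmu := (@tmu O B M).
Local Notation tmuV := (@tmuV O B M).
Local Notation tgamma := (@tgamma O B M).
Local Notation tswap := (@tswap O B M).
Local Notation typed := (@typed O B M P true).
Local Notation "t ~~ u" := (eqv S true t u).
Local Notation shuffle := (shuffle S true).
Local Notation letterwise := (letterwise S true).

(** The arrows given by box diagrams, with the boxes in the order of the source.
    Base morphisms are allowed anywhere in the construction, so that the class
    is visibly closed under substitution. *)
Inductive diagrammatic : mor M -> word M -> tm B M -> Prop :=
| dg_box phi : diagrammatic phi [:: phi] (id1 phi)
| dg_mu phi u d psi v e : diagrammatic phi u d -> diagrammatic psi v e ->
    diagrammatic (ten phi psi) (u ++ v) (tmu phi psi \c (d \x e))
| dg_gamma phi u d psi v e : src phi = tgt psi ->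
    diagrammatic phi u d -> diagrammatic psi v e ->
    diagrammatic (mcomp phi psi) (u ++ v) (tgamma phi psi \c (d \x e))
| dg_base s s' phi u d : acts s s' phi -> diagrammatic phi u d ->
    diagrammatic (act P s s' phi) u (tbase s phi s' \c d)
| dg_eqv phi u d e : diagrammatic phi u d -> d ~~ e -> diagrammatic phi u e.

(** The inverses of the arrows which multiply several letters. *)
Inductive splitting : mor M -> word M -> tm B M -> Prop :=
| sp_id phi : splitting phi [:: phi] (id1 phi)
| sp_muV phi u r psi v r' : splitting phi u r -> splitting psi v r' ->
    splitting (ten phi psi) (u ++ v) ((r \x r') \c tmuV phi psi)
| sp_eqv phi u r r' : splitting phi u r -> r ~~ r' -> splitting phi u r'.

Lemma typed_dg phi u d : diagrammatic phi u d -> typed u [:: phi] d.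
Proof.
elim=> {phi u d}.
- by move=> *; apply: ty_id.
- by move=> phi u d psi v e _ T _ T'; apply: ty_comp (ty_mu _ _ _ _) (ty_box T T').
- move=> phi u d psi v e E _ T _ T'.
  by apply: ty_comp (ty_gamma _ _ E) (ty_box T T').
- by move=> s s' phi u d A _ T; apply: ty_comp (ty_base _ _ A) T.
- by move=> phi u d e _ T E; apply: eqv_typed E T.
Qed.

Lemma typed_sp phi u r : splitting phi u r -> typed [:: phi] u r.
Proof.
elim=> {phi u r}.
- by move=> *; apply: ty_id.
- move=> phi u r psi v r' _ T _ T'.
  by apply: ty_comp (ty_box T T') (ty_muV _ _ _ _).
- by move=> phi u d e _ T E; apply: eqv_typed E T.
Qed.

(** Substitution of box diagrams into the boxes of a box diagram. *)
Lemma dg_comp phi u d v t : diagrammatic phi u d ->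
  letterwise diagrammatic u v t -> diagrammatic phi v (d \c t).
Proof.
move=> H; elim: H v t => {phi u d}.
- move=> phi v t /lw_letterV[d Hd E]; have Td := typed_dg Hd.
  by apply: dg_eqv Hd _; rewrite E comp1l; endpoints.
- move=> phi u d psi u' e Hd IH He IH' v t.
  move=> /lw_cat[v1 [v2 [t1 [t2 [-> L1 L2 E]]]]].
  have [Td Te] := (typed_dg Hd, typed_dg He).
  have [T1 T2] := (typed_lw typed_dg L1, typed_lw typed_dg L2).
  apply: dg_eqv (dg_mu (IH _ _ L1) (IH' _ _ L2)) _.
  by rewrite E -compA -box_comp; endpoints.
- move=> phi u d psi u' e C Hd IH He IH' v t.
  move=> /lw_cat[v1 [v2 [t1 [t2 [-> L1 L2 E]]]]].
  have [Td Te] := (typed_dg Hd, typed_dg He).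
  have [T1 T2] := (typed_lw typed_dg L1, typed_lw typed_dg L2).
  apply: dg_eqv (dg_gamma C (IH _ _ L1) (IH' _ _ L2)) _.
  by rewrite E -compA -box_comp; endpoints.
- move=> s s' phi u d A Hd IH v t L; apply: dg_eqv (dg_base A (IH _ _ L)) _.
  by rewrite compA.
- by move=> phi u d e _ IH E v t /IH H; apply: dg_eqv H _; rewrite E.
Qed.

Lemma sp_comp phi u r v t : splitting phi u r ->
  letterwise splitting u v t -> splitting phi v (t \c r).
Proof.
move=> H; elim: H v t => {phi u r}.
- move=> phi v t /lw_letterV[d Hd E]; have Td := typed_sp Hd.
  by apply: sp_eqv Hd _; rewrite E comp1r; endpoints.
- move=> phi u r psi u' r' Hr IH Hr' IH' v t.
  move=> /lw_cat[v1 [v2 [t1 [t2 [-> L1 L2 E]]]]].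
  have [Td Te] := (typed_sp Hr, typed_sp Hr').
  have [T1 T2] := (typed_lwV typed_sp L1, typed_lwV typed_sp L2).
  apply: sp_eqv (sp_muV (IH _ _ L1) (IH' _ _ L2)) _.
  by rewrite E compA -box_comp; endpoints.
- by move=> phi u d e _ IH E v t /IH H; apply: sp_eqv H _; rewrite E.
Qed.

Lemma lw_sp_comp u v w r r' : letterwise splitting u v r ->
  letterwise splitting v w r' -> letterwise splitting u w (r' \c r).
Proof.
move=> H; elim: H w r' => {u v r}.
- move=> w r /lw_nilV[-> E]; apply: lw_eqv (lw_nil _ _ _) _.
  by rewrite E comp1l.
- move=> phi u r u' v r' Hr Hr' IH w r1.
  move=> /lw_cat[v1 [v2 [t1 [t2 [-> L1 L2 E]]]]].
  have [Td Te] := (typed_sp Hr, typed_lwV typed_sp Hr').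
  have [T1 T2] := (typed_lwV typed_sp L1, typed_lwV typed_sp L2).
  apply: lw_eqv (lw_cons (sp_comp Hr L1) (IH _ _ L2)) _.
  by rewrite E -box_comp; endpoints.
- by move=> u v r r' _ IH E w r1 /IH H; apply: lw_eqv H _; rewrite E.
Qed.

Lemma lw_id u : letterwise splitting u u (tid u).
Proof.
elim: u => [|phi u IH]; first exact: lw_nil.
by apply: lw_eqv (lw_cons (sp_id phi) IH) _; rewrite box_id.
Qed.

Lemma dg_lw_comp u v w t t' : letterwise diagrammatic w v t ->
  letterwise diagrammatic v u t' -> letterwise diagrammatic w u (t \c t').
Proof.
move=> H; elim: H u t' => {w v t}.
- move=> u t' /lw_nilV[-> E]; apply: lw_eqv (lw_nil _ _ _) _.
  by rewrite E comp1l.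
- move=> phi u d w v t Hd Ht IH u' t'.
  move=> /lw_cat[v1 [v2 [t1 [t2 [-> L1 L2 E]]]]].
  have [Td Te] := (typed_dg Hd, typed_lw typed_dg Ht).
  have [T1 T2] := (typed_lw typed_dg L1, typed_lw typed_dg L2).
  apply: lw_eqv (lw_cons (dg_comp Hd L1) (IH _ _ L2)) _.
  by rewrite E -box_comp; endpoints.
- by move=> w v t t1 _ IH E u t' /IH H; apply: lw_eqv H _; rewrite E.
Qed.

Lemma lw_dg_id u : letterwise diagrammatic u u (tid u).
Proof.
elim: u => [|phi u IH]; first exact: lw_nil.
by apply: lw_eqv (lw_cons (dg_box phi) IH) _; rewrite box_id.
Qed.

(** Splittings come first and diagrams last: the three parts of the arrow
    represented by a box diagram with an enumeration of its boxes and a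
    decomposition of the source. *)
Definition normal v w t := exists u1 u2 d s r,
  [/\ letterwise diagrammatic w u2 d, shuffle u1 u2 s, letterwise splitting v u1 r
    & t ~~ d \c s \c r].

Lemma normal_eqv v w t t' : normal v w t -> t ~~ t' -> normal v w t'.
Proof.
move=> [u1 [u2 [d [s [r [Hd Hs Hr E]]]]]] E'.
by exists u1, u2, d, s, r; split=> //; rewrite -E'.
Qed.

Lemma normal_sp v w r : letterwise splitting v w r -> normal v w r.
Proof.
move=> Hr; have Tr := typed_lwV typed_sp Hr; exists w, w, (tid w), (tid w), r.
split=> //; [exact: lw_dg_id | exact: sh_id |].
by rewrite !comp1l; endpoints.
Qed.

Lemma normal_dg v w d : letterwise diagrammatic w v d -> normal v w d.
Proof.
move=> Hd; have Td := typed_lw typed_dg Hd; exists v, v, d, (tid v), (tid v).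
split=> //; [exact: sh_id | exact: lw_id |].
by rewrite !comp1r; endpoints.
Qed.

Lemma normal_box v w t v' w' t' : normal v w t -> normal v' w' t' ->
  normal (v ++ v') (w ++ w') (t \x t').
Proof.
move=> [u1 [u2 [d [s [r [Hd Hs Hr E]]]]]].
move=> [u1' [u2' [d' [s' [r' [Hd' Hs' Hr' E']]]]]].
have [Td Td'] := (typed_lw typed_dg Hd, typed_lw typed_dg Hd').
have [Ts Ts'] := (typed_shuffle Hs, typed_shuffle Hs').
have [Tr Tr'] := (typed_lwV typed_sp Hr, typed_lwV typed_sp Hr').
exists (u1 ++ u1'), (u2 ++ u2'), (d \x d'), (s \x s'), (r \x r').
split; [exact: lw_box | exact: sh_box | exact: lw_box |].
by rewrite E E' !box_comp; endpoints.
Qed.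

Lemma dg_normal v w w' d t : letterwise diagrammatic w' w d -> normal v w t ->
  normal v w' (d \c t).
Proof.
move=> Hd [u1 [u2 [d' [s [r [Hd' Hs Hr E]]]]]].
exists u1, u2, (d \c d'), s, r; split=> //; first exact: dg_lw_comp Hd Hd'.
by rewrite E !compA.
Qed.

Lemma shuffle_normal v w w' s t : shuffle w w' s -> normal v w t ->
  normal v w' (s \c t).
Proof.
move=> Hs [u1 [u2 [d' [s' [r [Hd' Hs' Hr E]]]]]].
have [v' [s1 [d1 [H1 H2 E1]]]] := shuffle_lw typed_dg Hs Hd'.
exists u1, v', d1, (s1 \c s'), r; split=> //; first exact: sh_comp H1 Hs'.
by rewrite E !compA E1.
Qed.

Lemma normal_sp_comp u v w t r : normal v w t -> letterwise splitting u v r ->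
  normal u w (t \c r).
Proof.
move=> [u1 [u2 [d' [s [r' [Hd' Hs Hr' E]]]]]] Hr.
exists u1, u2, d', s, (r' \c r); split=> //; first exact: lw_sp_comp Hr Hr'.
by rewrite E !compA.
Qed.

Lemma normal_shuffle u v w t s : normal v w t -> shuffle u v s ->
  normal u w (t \c s).
Proof.
move=> [u1 [u2 [d' [s' [r' [Hd' Hs' Hr' E]]]]]] Hs.
have [v' [s1 [r1 [H1 H2 E1]]]] := lw_shuffle typed_sp Hs Hr'.
exists v', u2, d', (s' \c s1), r1; split=> //; first exact: sh_comp Hs' H1.
by rewrite E -!compA E1.
Qed.

(** Associativity of mu, solved for a composite of one mu with an inverse mu. *)
Lemma muV_mul phi chi psi :
  tmuV phi (ten chi psi) \c tmu (ten phi chi) psi ~~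
  (id1 phi \x tmu chi psi) \c (tmuV phi chi \x id1 psi).
Proof.
rewrite -[tmu (ten phi chi) psi](comp1r S _ (w := [:: ten phi chi; psi])) //.
have -> : tid [:: ten phi chi; psi] ~~
    (tmu phi chi \x id1 psi) \c (tmuV phi chi \x id1 psi).
  by rewrite -box_comp ?muVK ?comp1l ?box_id.
by rewrite !compA -(compA _ _ (tmuV _ _)) muA compA muK comp1l.
Qed.

Lemma muV_mur phi chi psi :
  tmuV (ten phi chi) psi \c tmu phi (ten chi psi) ~~
  (tmu phi chi \x id1 psi) \c (id1 phi \x tmuV chi psi).
Proof.
rewrite -[tmu phi (ten chi psi)](comp1r S _ (w := [:: phi; ten chi psi])) //.
have -> : tid [:: phi; ten chi psi] ~~
    (id1 phi \x tmu chi psi) \c (id1 phi \x tmuV chi psi).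
  by rewrite -box_comp ?muVK ?comp1l ?box_id.
by rewrite !compA -(compA _ _ (tmuV _ _)) -muA compA muK comp1l.
Qed.

(** The interchange of gamma and mu, solved for the composite of gamma with an
    inverse mu. *)
Lemma muV_gamma phi1 phi2 psi1 psi2 : src phi1 = tgt psi1 -> src phi2 = tgt psi2 ->
  tmuV (mcomp phi1 psi1) (mcomp phi2 psi2) \c tgamma (ten phi1 phi2) (ten psi1 psi2)
  ~~ (tgamma phi1 psi1 \x tgamma phi2 psi2) \c
     (id1 phi1 \x tswap [:: phi2] [:: psi1] \x id1 psi2) \c
     (tmuV phi1 phi2 \x tmuV psi1 psi2).
Proof.
move=> C1 C2; have E := eqt_eqv (eqt_gamma_mu S true C1 C2).
have K : (id1 phi1 \x tswap [:: psi1] [:: phi2] \x id1 psi2) \c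
    (id1 phi1 \x tswap [:: phi2] [:: psi1] \x id1 psi2) ~~
    tid [:: phi1; phi2; psi1; psi2].
  by rewrite -!box_comp // swapK !comp1l // !box_id.
rewrite -[tgamma phi1 psi1 \x _](comp1l S _
  (w := [:: mcomp phi1 psi1; mcomp phi2 psi2])) // -muK.
rewrite -(compA _ _ _ (tmu _ _) (_ \x _)).
rewrite -E -!compA (compA _ _ (_ \x _ \x _)) K.
by rewrite comp1l // -box_comp // !muVK box_id comp1r.
Qed.

Lemma muV_base s1 s1' s2 s2' phi1 phi2 : acts s1 s1' phi1 -> acts s2 s2' phi2 ->
  tmuV (act P s1 s1' phi1) (act P s2 s2' phi2) \c
    tbase (ten s1 s2) (ten phi1 phi2) (ten s1' s2') ~~
  (tbase s1 phi1 s1' \x tbase s2 phi2 s2') \c tmuV phi1 phi2.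
Proof.
move=> A1 A2; have E := eqt_eqv (eqt_mu_base S true A1 A2).
rewrite -[tbase (ten _ _) _ _](comp1r S _ (w := [:: ten phi1 phi2])) //.
by rewrite -muVK (compA _ _ (tbase _ _ _)) -E !compA muK comp1l.
Qed.

Lemma muV_swap (Y : sym_pointing P) phi psi : S = Some Y ->
  tmuV psi phi \c tbase (Csrc Y phi psi) (ten phi psi) (Ctgt Y phi psi) ~~
  tswap [:: phi] [:: psi] \c tmuV phi psi.
Proof.
move=> def_S; have E := eqt_eqv (eqt_mu_swap true phi psi def_S).
rewrite -[tbase _ _ _](comp1r S _ (w := [:: ten phi psi])) //.
by rewrite -muVK (compA _ _ (tbase _ _ _)) -E !compA muK comp1l.
Qed.

Section Splitting.
Hypothesis loc : localizable S.

(** An inverse mu moves back through a box diagram. At a product of two diagrams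
    condition (2) of localizability locates the separation between phi1 and
    phi2, at a gamma condition (3) continues it through both factors, at a base
    morphism condition (1) splits this morphism as well, and at a box the
    separation cuts the box. *)
Lemma dg_split phi u d phi1 phi2 : diagrammatic phi u d ->
  phi = ten phi1 phi2 -> normal u [:: phi1; phi2] (tmuV phi1 phi2 \c d).
Proof.
case: loc => loc1 loc2 loc3 H; elim: H phi1 phi2 => {phi u d}.
- move=> phi phi1 phi2 ->; apply: normal_sp; apply: lw_letter.
  apply: sp_eqv (sp_muV (sp_id _) (sp_id _)) _.
  by rewrite box_id comp1l // comp1r.
- move=> psi1 u d psi2 v e Hd IHd He IHe phi1 phi2.
  have [Td Te] := (typed_dg Hd, typed_dg He).
  move=> /loc2[chi [[E1 E2]|[E1 E2]]].
    (* The separation runs through the left factor. *)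
    subst psi1 phi2.
    apply: normal_eqv (dg_normal (_ : letterwise _ _ [:: phi1; chi; psi2] _)
      (normal_box (IHd _ _ (erefl _)) (normal_dg (lw_letter _ _ He)))) _.
      exact: (lw_cons (dg_box phi1)
        (lw_letter _ _ (dg_mu (dg_box chi) (dg_box psi2)))).
    rewrite box_id comp1r // compA muV_mul -compA.
    by rewrite -(box_comp S _ (t := tmuV _ _)) ?comp1l; endpoints.
  (* The separation runs through the right factor. *)
  subst phi1 psi2.
  apply: normal_eqv (dg_normal (_ : letterwise _ _ [:: psi1; chi; phi2] _)
    (normal_box (normal_dg (lw_letter _ _ Hd)) (IHe _ _ (erefl _)))) _.
    exact: (lw_cons (dg_mu (dg_box psi1) (dg_box chi))
      (lw_letter _ _ (dg_box phi2))).
  rewrite box_id comp1r // compA muV_mur -compA.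
  by rewrite -(box_comp S _ (u := tmuV _ _)) ?comp1l; endpoints.
- move=> psi1 u d psi2 v e C Hd IHd He IHe phi1 phi2.
  have [Td Te] := (typed_dg Hd, typed_dg He).
  move=> /(loc3 _ _ _ _ C)[x1 [x2 [x3 [x4 [E1 E2 [C1 C2] def1 def2]]]]].
  subst psi1 psi2 phi1 phi2.
  apply: normal_eqv (dg_normal (_ : letterwise _ _ ([:: x1; x3] ++ [:: x2; x4]) _)
    (shuffle_normal (_ : shuffle [:: x1; x2; x3; x4] _ _)
      (normal_box (IHd _ _ (erefl _)) (IHe _ _ (erefl _))))) _.
  + exact: (lw_cons (dg_gamma C1 (dg_box _) (dg_box _))
             (lw_letter _ _ (dg_gamma C2 (dg_box _) (dg_box _)))).
  + exact: (sh_box (sh_box (sh_id _ _ [:: x1]) (sh_swap _ _ [:: x2] [:: x3]))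
             (sh_id _ _ [:: x4])).
  + rewrite !box_id !comp1r // (compA _ _ (tmuV _ _)) muV_gamma // -!compA.
    by rewrite -(box_comp S _ (t := tmuV _ _)); endpoints.
- move=> s s' phi u d A Hd IH phi1 phi2.
  have Td := typed_dg Hd.
  move=> /(loc1 _ _ _ _ _ A)[q1 [q2 [s1 [s1' [s2 [s2' [def_phi]]]]]]].
  subst phi; case.
    case=> A1 A2 -> -> [def_s def_s']; subst s s'.
    apply: normal_eqv (dg_normal (_ : letterwise _ _ [:: q1; q2] _)
      (IH _ _ (erefl _))) _.
      exact: (lw_cons (dg_base A1 (dg_box _))
      (lw_letter _ _ (dg_base A2 (dg_box _)))).
    rewrite !comp1r // !compA.
    by rewrite muV_base // -!compA.
  (* The base morphism exchanges the two factors; so does a swap of letters. *)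
  case def_S: S => [Y|//] [A1 A2 -> -> [def_s def_s']]; subst s s'.
  have A' : acts (ten s1 s2) (ten s1' s2') (ten q2 q1) by apply: acts_ten.
  apply: normal_eqv (dg_normal (_ : letterwise _ _ [:: q2; q1] _)
    (shuffle_normal (sh_swap _ _ [:: q1] [:: q2]) (IH _ _ (erefl _)))) _.
    exact: (lw_cons (dg_base A1 (dg_box _))
      (lw_letter _ _ (dg_base A2 (dg_box _)))).
  have AC := acts_C Y q1 q2; have EC := act_C Y q1 q2.
  have A'' : acts (ten s1 s2) (ten s1' s2')
      (act P (Csrc Y q1 q2) (Ctgt Y q1 q2) (ten q1 q2)).
    by rewrite EC.
  rewrite -(eqt_eqv (eqt_base_comp S true AC A'')) EC.
  rewrite !comp1r // !compA muV_base // -!compA.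
  by rewrite (compA _ _ (tmuV q2 q1)) muV_swap // -!compA.
- move=> phi u d e _ IH E phi1 phi2 /IH N; apply: normal_eqv N _.
  by rewrite E.
Qed.
End Splitting.
End Diagrammatic.

(** * Composition of normal arrows and reduction to letters *)

Section NormalForms.
Variables (O : obj_monoid) (B M : moncat O) (P : pointing B M).
Variable S : option (sym_pointing P).
Implicit Types (phi psi : mor M) (t d r : tm B M) (u v w : word M).

Local Notation "t \c u" := (tcomp t u).
Local Notation "t \x u" := (tbox t u).
Local Notation tid := (@tid O B M).
Local Notation id1 phi := (tid [:: phi]).
Local Notation tmu := (@tmu O B M).
Local Notation tmuV := (@tmuV O B M).
Local Notation tgamma := (@tgamma O B M).
Local Notation tswap := (@tswap O B M).
Local Notation typed := (@typed O B M P true).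
Local Notation "t ~~ u" := (eqv S true t u).
Local Notation letterwise := (letterwise S true).
Local Notation splitting := (splitting S).
Local Notation diagrammatic := (diagrammatic S).
Local Notation normal := (normal S).
Local Notation mu_iter := (@mu_iter O B M).
Local Notation muV_iter := (@muV_iter O B M).

Section Composition.
Hypothesis loc : localizable S.

Lemma sp_dg_normal phi u v r d : splitting phi v r -> diagrammatic phi u d ->
  normal u v (r \c d).
Proof.
move=> H; elim: H u d => {phi v r}.
- move=> phi u d Hd; have Td := typed_dg Hd.
  apply: normal_eqv (normal_dg (lw_letter _ _ Hd)) _.
  by rewrite comp1l; endpoints.
- move=> phi u r psi v r' Hr IH Hr' IH' u0 d Hd.
  have [Tr Tr'] := (typed_sp Hr, typed_sp Hr').
  have [u1 [u2 [d' [s [r0 [Hd' Hs Hr0 E]]]]]] := dg_split loc Hd (erefl _).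
  have [v1 [v2 [d1 [d2 [? L1 L2 Ed]]]]] := lw_cat (w1 := [:: phi]) Hd'.
  subst u2.
  have [e1 H1 E1] := lw_letterV L1; have [e2 H2 E2] := lw_letterV L2.
  have [Te1 Te2] := (typed_dg H1, typed_dg H2).
  apply: normal_eqv (normal_sp_comp (normal_shuffle
    (normal_box (IH _ _ H1) (IH' _ _ H2)) Hs) Hr0) _.
  by rewrite -(compA _ _ _ _ d) E Ed E1 E2 box_comp ?compA; endpoints.
- move=> phi v r r' _ IH E u d /IH N; apply: normal_eqv N _.
  by rewrite E.
Qed.

Lemma lw_sp_dg_normal u v w r d : letterwise splitting w v r ->
  letterwise diagrammatic w u d -> normal u v (r \c d).
Proof.
move=> H; elim: H u d => {w v r}.
- move=> u d /lw_nilV[-> E]; apply: normal_eqv (normal_dg (lw_nil _ _ _)) _.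
  by rewrite E comp1l.
- move=> phi u r w v r' Hr Hr' IH u0 d.
  move=> /(lw_cat (w1 := [:: phi]))[v1 [v2 [d1 [d2 [-> L1 L2 Ed]]]]].
  have [e1 H1 E1] := lw_letterV L1.
  have [Tr Tr'] := (typed_sp Hr, typed_lwV (@typed_sp _ _ _ _ _) Hr').
  have [Te1 Td2] := (typed_dg H1, typed_lw (@typed_dg _ _ _ _ _) L2).
  apply: normal_eqv (normal_box (sp_dg_normal Hr H1) (IH _ _ L2)) _.
  by rewrite Ed E1 box_comp; endpoints.
- move=> phi v r r' _ IH E u d /IH N; apply: normal_eqv N _.
  by rewrite E.
Qed.

Lemma normal_comp u v w t t' : normal v w t -> normal u v t' -> normal u w (t \c t').
Proof.
move=> [u1 [u2 [d [s [r [Hd Hs Hr E]]]]]].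
move=> [u1' [u2' [d' [s' [r' [Hd' Hs' Hr' E']]]]]].
apply: normal_eqv (normal_sp_comp (normal_shuffle (dg_normal Hd (shuffle_normal Hs
  (lw_sp_dg_normal Hr Hd'))) Hs') Hr') _.
by rewrite E E' !compA.
Qed.

End Composition.

(** Any order of binary splittings gives the same arrow, by coherence for mu. *)
Lemma splitting_muV phi u r : splitting phi u r ->
  [/\ u <> [::], phi = big_ten u & r ~~ muV_iter u].
Proof.
move=> Hr; suff [n E K] : [/\ u <> [::], phi = big_ten u & mu_iter u \c r ~~ id1 phi].
  split=> //; have Tr := typed_sp Hr; have Tu := typed_muV_iter P u.
  rewrite -(comp1l S _ (typed_cod Tr)) -mu_iterK -compA K comp1r //.
  by rewrite (typed_dom Tu) E.
elim: Hr => {phi u r}.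
- by move=> phi; split; rewrite ?big_ten1 //= comp1l.
- move=> phi u r psi v r' Hr [n1 E1 K1] Hr' [n2 E2 K2].
  split; [by case: u n1 {Hr E1 K1} | by rewrite big_ten_cat -E1 -E2|].
  have [Tr Tr'] := (typed_sp Hr, typed_sp Hr').
  have [Tu Tv] := (typed_mu_iter P true u, typed_mu_iter P true v).
  rewrite mu_iter_cat -E1 -E2 -!compA (compA _ _ (_ \x _)) -box_comp; [|by endpoints..].
  by rewrite K1 K2 box_id comp1l // muVK.
- by move=> phi u r r' _ [n E K] E'; split; rewrite -?E'.
Qed.

(** An induction principle for the reduced category: a property of arrows
    between letters which respects composition and product holds for all of
    them if it holds for base morphisms and for the arrows that gamma and the
    symmetry induce on products of two letters. *)
Section Reduction.
Variable K : mor M -> mor M -> tm B M -> Prop.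
Hypothesis K_eqv : forall phi psi t t', K phi psi t -> t ~~ t' -> K phi psi t'.
Hypothesis K_comp : forall phi psi chi t t',
  K psi chi t -> K phi psi t' -> K phi chi (t \c t').
Hypothesis K_ten : forall phi1 phi2 psi1 psi2 t1 t2,
  K phi1 psi1 t1 -> K phi2 psi2 t2 ->
  K (ten phi1 phi2) (ten psi1 psi2) (red_ten phi1 phi2 psi1 psi2 t1 t2).
Hypothesis K_base : forall s s' phi, acts s s' phi ->
  K phi (act P s s' phi) (tbase s phi s').
Hypothesis K_gamma : forall phi psi, src phi = tgt psi ->
  K (ten phi psi) (mcomp phi psi) (tgamma phi psi \c tmuV phi psi).
Hypothesis K_swap : forall phi psi,
  K (ten phi psi) (ten psi phi) (tmu psi phi \c tswap [:: phi] [:: psi] \c tmuV phi psi).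

(** Identities are base morphisms. *)
Lemma K_id phi : K phi phi (id1 phi).
Proof.
have K1 := K_base (acts_id B phi); rewrite act_id in K1.
by apply: K_eqv K1 _; apply: eqt_eqv; apply: eqt_base_id.
Qed.

(** Induction on t needs words as endpoints; they are reduced to letters by the
    iterated mu's. This map is functorial and monoidal, as muV_iter is inverse
    to mu_iter, and it sends mu and its unit to identities. *)
Lemma reduction v w t : typed v w t ->
  K (big_ten v) (big_ten w) (mu_iter w \c t \c muV_iter v).
Proof.
elim=> {v w t}.
- move=> w; apply: K_eqv (K_id _) _.
  have Tw := typed_mu_iter P true w.
  by rewrite comp1r ?muV_iterK; endpoints.
- move=> w1 w2 w3 t t' T IH T' IH'; apply: K_eqv (K_comp IH IH') _.
  have [Ti Ti'] := (typed_mu_iter P true w2, typed_muV_iter P w2).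
  by rewrite -!compA (compA _ _ (muV_iter _)) mu_iterK comp1l; endpoints.
- move=> w1 w1' w2 w2' t t' T IH T' IH'; rewrite !big_ten_cat.
  apply: K_eqv (K_ten IH IH') _; rewrite /red_ten.
  have [T1 T1'] := (typed_muV_iter P w1, typed_muV_iter P w2).
  have [T2 T2'] := (typed_mu_iter P true w1', typed_mu_iter P true w2').
  rewrite mu_iter_cat muV_iter_cat !compA -(compA _ _ _ (_ \x _) (t \x _)).
  rewrite -box_comp; [|by endpoints..].
  by rewrite -(compA _ _ _ (_ \x _) (_ \x _)) -box_comp; [|by endpoints..].
- move=> w1 w2; rewrite !big_ten_cat; apply: K_eqv (K_swap _ _) _.
  have [T1 T1'] := (typed_muV_iter P w1, typed_muV_iter P w2).
  have [T2 T2'] := (typed_mu_iter P true w1, typed_mu_iter P true w2).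
  rewrite mu_iter_cat muV_iter_cat !compA -(compA _ _ _ _ (tswap _ _)).
  rewrite -(swap_nat S T2 T2') !compA -(compA _ _ _ (_ \x _) (_ \x _)).
  by rewrite -box_comp ?muV_iterK ?box_id ?comp1r //; endpoints.
- move=> s phi s' A; rewrite !big_ten1; apply: K_eqv (K_base A) _.
  by rewrite /= comp1l // comp1r.
- move=> phi psi C; rewrite big_ten1 /= ten1r; apply: K_eqv (K_gamma C) _.
  by rewrite comp1l // box_id comp1l.
- move=> phi psi; rewrite big_ten1 /= ten1r; apply: K_eqv (K_id _) _.
  by rewrite comp1l // box_id comp1l // muVK.
- rewrite big_ten1; apply: K_eqv (K_id _) _.
  by rewrite /= comp1l //; symmetry; apply: eqt_eqv; apply: eqt_mu1VK.
- move=> phi psi _; rewrite big_ten1 /= ten1r; apply: K_eqv (K_id _) _.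
  by rewrite comp1r // box_id comp1r // muVK.
- move=> _; rewrite big_ten1; apply: K_eqv (K_id _) _.
  by rewrite /= comp1r //; symmetry; apply: eqt_eqv; apply: eqt_mu1VK.
Qed.

Lemma reduced_ind phi psi t : red P phi psi t -> K phi psi t.
Proof.
rewrite /red => T; have Kt := reduction T; rewrite !big_ten1 /= in Kt.
by apply: K_eqv Kt _; rewrite comp1l ?comp1r; endpoints.
Qed.
End Reduction.
End NormalForms.

(** * From diagrammatic arrows to box diagrams *)

Section Subdivisions.

Lemma leaves_uniq d : uniq (leaves d).
Proof.
elim: d => //= a IHa b IHb; rewrite cat_uniq !map_inj_uniq ?IHa ?IHb //;
  try by [move=> ? ? [] | move=> ? ? []].
- by rewrite andbT; apply/hasPn => _ /mapP[x _ ->]; apply/mapP => -[].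
- by rewrite andbT; apply/hasPn => _ /mapP[x _ ->]; apply/mapP => -[].
Qed.

Lemma mem_leaves d (x : box d) : x \in leaves d.
Proof.
elim: d x => [[]|a IHa b IHb [x|x]|a IHa b IHb [x|x]] //=; rewrite mem_cat.
- by rewrite map_f.
- by rewrite orbC map_f.
- by rewrite orbC map_f.
- by rewrite map_f.
Qed.

Lemma leaves_enum d : perm_eq (leaves d) (enum (box d)).
Proof.
apply: uniq_perm; [exact: leaves_uniq | exact: enum_uniq |].
by move=> x; rewrite mem_leaves mem_enum.
Qed.

Lemma top_row_nil d : top_row d <> [::].
Proof. by elim: d => //= a; [case: (top_row a)|case: (top_row a)]. Qed.

Lemma bottom_row_nil d : bottom_row d <> [::].
Proof. by elim: d => //= a + b; [case: (bottom_row a)|case: (bottom_row b)]. Qed.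

Lemma above_cut_nil d (c : cut d) : above_cut c <> [::].
Proof.
elim: d c => [[]|a IHa b IHb [c|c]|a IHa b IHb [[c|c]|]] /=.
- by case: (above_cut c) (IHa c).
- by case: (above_cut c) (IHb c).
- by case: (above_cut c) (IHa c).
- by case: (above_cut c) (IHb c).
- by case: (bottom_row a) (@bottom_row_nil a).
Qed.

Lemma below_cut_nil d (c : cut d) : below_cut c <> [::].
Proof.
elim: d c => [[]|a IHa b IHb [c|c]|a IHa b IHb [[c|c]|]] /=.
- by case: (below_cut c) (IHa c).
- by case: (below_cut c) (IHb c).
- by case: (below_cut c) (IHa c).
- by case: (below_cut c) (IHb c).
- by case: (top_row b) (@top_row_nil b).
Qed.

End Subdivisions.

Section Diagrams.
Variables (O : obj_monoid) (B M : moncat O) (P : pointing B M).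
Variable S : option (sym_pointing P).
Implicit Types (phi psi : mor M) (t : tm B M) (u v w : word M).

Local Notation "t \c u" := (tcomp t u).
Local Notation "t \x u" := (tbox t u).
Local Notation tid := (@tid O B M).
Local Notation id1 phi := (tid [:: phi]).
Local Notation tmu := (@tmu O B M).
Local Notation tgamma := (@tgamma O B M).
Local Notation typed := (@typed O B M P true).
Local Notation "t ~~ u" := (eqv S true t u).

Lemma big_tenO_cat (xs ys : seq O) :
  big_tenO (xs ++ ys) = tenO (big_tenO xs) (big_tenO ys).
Proof. by elim: xs => [|x xs IH] /=; rewrite ?ten1O // IH tenOA. Qed.

Definition valid_cuts d (lw : box d -> mor M) (lc : cut d -> mor B) :=
  forall c, src (lc c) = big_tenO [seq tgt (lw b) | b <- above_cut c] /\
            tgt (lc c) = big_tenO [seq src (lw b) | b <- below_cut c].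

(** The rows along a cut are never empty, so both conditions hold at a cut, and
    one of them at the top and at the bottom. *)
Lemma valid_diagramP d (lw : box d -> mor M) (lb : hseg d -> mor B) :
  valid_diagram lw lb <->
  [/\ tgt (lb Top) = big_tenO [seq src (lw b) | b <- top_row d],
      src (lb Bottom) = big_tenO [seq tgt (lw b) | b <- bottom_row d] &
      valid_cuts lw (fun c => lb (Cut c))].
Proof.
split=> [V|[VT VB VC] [||c]] /=.
- split; first by apply: (V Top).2; apply: top_row_nil.
    by apply: (V Bottom).1; apply: bottom_row_nil.
  move=> c; split; first by apply: (V (Cut c)).1; apply: above_cut_nil.
  by apply: (V (Cut c)).2; apply: below_cut_nil.
- by [].
- by [].
- by have [] := VC c.
Qed.

(** The arrows [inner_tm]: between two factors of a gamma there is exactly one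
    base morphism, acting on the source of the lower factor. *)
Inductive cut_arrow : mor M -> word M -> tm B M -> Prop :=
| ca_box phi : cut_arrow phi [:: phi] (id1 phi)
| ca_mu phi u t psi v t' : cut_arrow phi u t -> cut_arrow psi v t' ->
    cut_arrow (ten phi psi) (u ++ v) (tmu phi psi \c (t \x t'))
| ca_gamma phi s u t psi v t' : tgt s = src phi -> src s = tgt psi ->
    cut_arrow phi u t -> cut_arrow psi v t' ->
    cut_arrow (mcomp (mcomp phi (P s)) psi) (u ++ v)
      (tgamma (mcomp phi (P s)) psi \c
         ((tbase s phi (idm (tgt phi)) \c t) \x t')).

Lemma src_tgt_composite d (lw : box d -> mor M) (lc : cut d -> mor B) :
  valid_cuts lw lc ->
  src (composite P lw lc) = big_tenO [seq src (lw b) | b <- top_row d] /\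
  tgt (composite P lw lc) = big_tenO [seq tgt (lw b) | b <- bottom_row d].
Proof.
elim: d lw lc => [|a IHa b IHb|a IHa b IHb] lw lc V /=.
- by rewrite !tenO1.
- have Va : valid_cuts (fun x => lw (inl x)) (fun c => lc (inl c)).
    by move=> c; have := V (inl c); rewrite /= -!map_comp.
  have Vb : valid_cuts (fun x => lw (inr x)) (fun c => lc (inr c)).
    by move=> c; have := V (inr c); rewrite /= -!map_comp.
  have [Sa Ta] := IHa _ _ Va; have [Sb Tb] := IHb _ _ Vb.
  by rewrite src_ten tgt_ten Sa Sb Ta Tb !map_cat -!map_comp !big_tenO_cat.
- have Va : valid_cuts (fun x => lw (inl x)) (fun c => lc (Some (inl c))).
    by move=> c; have := V (Some (inl c)); rewrite /= -!map_comp.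
  have Vb : valid_cuts (fun x => lw (inr x)) (fun c => lc (Some (inr c))).
    by move=> c; have := V (Some (inr c)); rewrite /= -!map_comp.
  have [Sa Ta] := IHa _ _ Va; have [Sb Tb] := IHb _ _ Vb.
  have [Vs Vt] := V None; rewrite /= -!map_comp in Vs Vt.
  rewrite -!map_comp src_comp ?tgt_comp ?src_comp ?src_p ?tgt_p ?Vs ?Vt //.
Qed.

Lemma typed_inner_tm l d (lw : box d -> mor M) (lc : cut d -> mor B) :
  valid_cuts lw lc ->
  Defs.typed P l (map lw (leaves d)) [:: composite P lw lc] (inner_tm P lw lc).
Proof.
elim: d lw lc => [|a IHa b IHb|a IHa b IHb] lw lc V /=.
- exact: ty_id.
- have Va : valid_cuts (fun x => lw (inl x)) (fun c => lc (inl c)).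
    by move=> c; have := V (inl c); rewrite /= -!map_comp.
  have Vb : valid_cuts (fun x => lw (inr x)) (fun c => lc (inr c)).
    by move=> c; have := V (inr c); rewrite /= -!map_comp.
  rewrite map_cat -!map_comp.
  exact: ty_comp (ty_mu _ _ _ _) (ty_box (IHa _ _ Va) (IHb _ _ Vb)).
- have Va : valid_cuts (fun x => lw (inl x)) (fun c => lc (Some (inl c))).
    by move=> c; have := V (Some (inl c)); rewrite /= -!map_comp.
  have Vb : valid_cuts (fun x => lw (inr x)) (fun c => lc (Some (inr c))).
    by move=> c; have := V (Some (inr c)); rewrite /= -!map_comp.
  have [_ Ta] := src_tgt_composite Va; have [Sb _] := src_tgt_composite Vb.
  have [Vs Vt] := V None; rewrite /= -!map_comp in Vs Vt.
  rewrite map_cat -!map_comp.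
  set phi := composite P (fun x => lw (inr x)) _.
  have A : tgt (lc None) = src phi by rewrite Vt Sb.
  have Tb : Defs.typed P l (map (fun x => lw (inr x)) (leaves b))
      [:: mcomp phi (P (lc None))]
      (tbase (lc None) phi (idm (tgt phi)) \c
       inner_tm P (fun x => lw (inr x)) (fun c => lc (Some (inr c)))).
    apply: ty_comp (IHb _ _ Vb); rewrite -(act_src _ A).
    by apply: ty_base; split; rewrite ?src_id.
  apply: ty_comp (ty_box Tb (IHa _ _ Va)); apply: ty_gamma.
  by rewrite src_comp ?src_p ?tgt_p ?Vs ?Ta.
Qed.

Lemma cut_arrow_diagram phi u t : cut_arrow phi u t ->
  exists d (lw : box d -> mor M) (lc : cut d -> mor B),
    [/\ valid_cuts lw lc, phi = composite P lw lc, u = map lw (leaves d) &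
        t = inner_tm P lw lc].
Proof.
elim=> {phi u t}.
- move=> phi; exists Whole, (fun _ => phi), (fun c : void => match c with end).
  by split=> // -[].
- move=> phi u t psi v t' _ [a [lwa [lca [Va -> -> ->]]]].
  move=> _ [b [lwb [lcb [Vb -> -> ->]]]].
  exists (Beside a b), (fun x => match x with inl y => lwa y | inr y => lwb y end),
    (fun c => match c with inl c => lca c | inr c => lcb c end).
  split=> //; last by rewrite /= map_cat -!map_comp.
  by case=> c /=; rewrite -!map_comp; [apply: Va | apply: Vb].
- move=> phi s u t psi v t' As At _ [b [lwb [lcb [Vb Eb -> ->]]]].
  move=> _ [a [lwa [lca [Va Ea -> ->]]]].
  subst phi psi.
  exists (Above a b), (fun x => match x with inl y => lwa y | inr y => lwb y end),
    (fun c => match c with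
              | None => s | Some (inl c) => lca c | Some (inr c) => lcb c end).
  split=> //; last by rewrite /= map_cat -!map_comp.
  case=> [[c|c]|] /=; rewrite -!map_comp; [apply: Va | apply: Vb |].
  have [Sa Ta] := src_tgt_composite Va; have [Sb Tb] := src_tgt_composite Vb.
  by rewrite At As Ta Sb.
Qed.

Lemma base_split s s' phi : acts s s' phi ->
  tbase s phi s' ~~
  tbase (idm (src (mcomp phi (P s)))) (mcomp phi (P s)) s' \c
    tbase s phi (idm (tgt phi)).
Proof.
case=> a1 a2; have A1 : acts s (idm (tgt phi)) phi by rewrite /acts src_id.
have E : src (mcomp phi (P s)) = src s by rewrite src_comp ?src_p ?tgt_p.
have A2 : acts (idm (src (mcomp phi (P s)))) s' (act P s (idm (tgt phi)) phi).
  by rewrite act_src // /acts tgt_id tgt_comp ?tgt_p.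
have := eqt_eqv (eqt_base_comp S true A1 A2).
by rewrite act_src // E comp_idr -a2 comp_idr => ->.
Qed.

(** In a vertical juxtaposition, the base morphism below the upper part and the
    one above the lower part compose to a base morphism on the cut, and the two
    outer ones act on the whole. *)
Lemma gamma_base s1 s1' q1 s0 s0' q0 : acts s1 s1' q1 -> acts s0 s0' q0 ->
  src s1 = tgt s0' ->
  let s := mcomp s1 s0' in
  let chi := mcomp (mcomp q1 (P s)) q0 in
  tgamma (act P s1 s1' q1) (act P s0 s0' q0) \c
    (tbase s1 q1 s1' \x tbase s0 q0 s0') ~~
  tbase s0 chi s1' \c tgamma (mcomp q1 (P s)) q0 \c
    (tbase s q1 (idm (tgt q1)) \x id1 q0).
Proof.
move=> A1 A0 C s chi; have [a1 b1] := A1; have [a0 b0] := A0.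
have Ts : tgt s = src q1 by rewrite /s tgt_comp.
have Ss : src s = tgt q0 by rewrite /s src_comp.
have Cq : src (mcomp q1 (P s)) = tgt q0 by rewrite src_comp ?src_p ?tgt_p.
have Ac : acts s0 s1' chi.
  by rewrite /acts src_comp // tgt_comp // tgt_comp ?tgt_p.
rewrite (eqt_eqv (eqt_gamma_outer S true Cq Ac)) -compA -box_comp //; last first.
  by rewrite /= act_src.
have As : acts s s1' q1 by split.
rewrite -(base_split As) comp1r //.
have A2 : acts s0' (idm (tgt s1')) (act P s1 s1' q1).
  by rewrite /acts src_id src_act // tgt_act.
have -> : tbase s q1 s1' ~~
    tbase s0' (act P s1 s1' q1) (idm (tgt s1')) \c tbase s1 q1 s1'.
  by rewrite (eqt_eqv (eqt_base_comp S true A1 A2)) comp_idl.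
have E : mcomp (act P s1 s1' q1) (P s0') = mcomp (P s1') (mcomp q1 (P s)).
  rewrite /act /s p_comp // !mcompA ?(src_comp, tgt_comp, src_p, tgt_p) //.
have T0 : tgt s0' = src (act P s1 s1' q1) by rewrite src_act.
have S0 : src s0' = tgt (mcomp q0 (P s0)) by rewrite tgt_comp ?tgt_p.
have := eqt_eqv (eqt_gamma_inner S true T0 S0).
rewrite E tgt_act // -/(act P s0 s0' q0) => I.
rewrite -[tbase s0 q0 (idm _)](comp1l S true (w := [:: mcomp q0 (P s0)])); last first.
  by rewrite /= act_src.
rewrite box_comp //; last by rewrite /= act_src.
rewrite compA -I -compA -box_comp //; last by rewrite /= act_src.
by rewrite comp1l // -base_split.
Qed.

Lemma typed_ca phi u t : cut_arrow phi u t -> typed u [:: phi] t.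
Proof.
move=> /cut_arrow_diagram[d [lw [lc [V -> -> ->]]]]; exact: typed_inner_tm.
Qed.

(** All base morphisms in a box diagram can be moved to the cuts, the top and
    the bottom. *)
Lemma diagrammatic_cut phi u d : diagrammatic S phi u d ->
  exists s s' psi t, [/\ acts s s' psi, phi = act P s s' psi, cut_arrow psi u t &
    d ~~ tbase s psi s' \c t].
Proof.
elim=> {phi u d}.
- move=> phi; exists (idm (src phi)), (idm (tgt phi)), phi, (id1 phi).
  split; [exact: acts_id | by rewrite act_id | exact: ca_box |].
  by rewrite comp1r //; symmetry; apply: eqt_eqv; apply: eqt_base_id.
- move=> phi u d psi v e _ [s1 [s1' [q1 [t1 [A1 -> C1 E1]]]]].
  move=> _ [s2 [s2' [q2 [t2 [A2 -> C2 E2]]]]].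
  have [T1 T2] := (typed_ca C1, typed_ca C2).
  exists (ten s1 s2), (ten s1' s2'), (ten q1 q2), (tmu q1 q2 \c (t1 \x t2)).
  split; [exact: acts_ten | by rewrite act_ten | exact: ca_mu |].
  rewrite E1 E2 box_comp; [|by endpoints..].
  by rewrite !compA (eqt_eqv (eqt_mu_base S true A1 A2)).
- move=> phi u d psi v e C _ [s1 [s1' [q1 [t1 [A1 def_phi C1 E1]]]]].
  move=> _ [s0 [s0' [q0 [t0 [A0 def_psi C0 E0]]]]]; subst phi psi.
  have [T1 T0] := (typed_ca C1, typed_ca C0).
  have [[a1 b1] [a0 b0]] := (A1, A0).
  rewrite src_act // tgt_act // in C.
  have Ts : tgt (mcomp s1 s0') = src q1 by rewrite tgt_comp.
  have Ss : src (mcomp s1 s0') = tgt q0 by rewrite src_comp.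
  have Cq : src (mcomp q1 (P (mcomp s1 s0'))) = tgt q0.
    by rewrite src_comp ?src_p ?tgt_p.
  exists s0, s1', (mcomp (mcomp q1 (P (mcomp s1 s0'))) q0),
    (tgamma (mcomp q1 (P (mcomp s1 s0'))) q0 \c
       ((tbase (mcomp s1 s0') q1 (idm (tgt q1)) \c t1) \x t0)).
  split.
  + by rewrite /acts src_comp // tgt_comp // tgt_comp ?tgt_p.
  + rewrite /act p_comp //.
    by rewrite !mcompA ?(src_comp, tgt_comp, src_p, tgt_p).
  + exact: ca_gamma.
  + rewrite E1 E0 box_comp; [|by endpoints..].
    rewrite compA gamma_base // -!compA.
    by rewrite -(box_comp S _ (u := id1 _)) ?comp1l; endpoints.
- move=> s s' phi u d A _ [s1 [s1' [q [t [A1 def_phi C E]]]]]; subst phi.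
  exists (mcomp s1 s), (mcomp s' s1'), q, t; split=> //.
  + exact: acts_comp A1 A.
  + by rewrite act_comp.
  + by rewrite E compA (eqt_eqv (eqt_base_comp S true A1 A)).
- move=> phi u d e _ [s [s' [psi [t [A Ep C E]]]]] E'.
  by exists s, s', psi, t; split=> //; rewrite -E'.
Qed.

Lemma normal_box_roof phi psi t : normal S [:: phi] [:: psi] t ->
  exists w Gam, box_roof S phi psi w Gam /\ redE S phi psi t (roof_mor w Gam).
Proof.
move=> [u1 [u2 [d [s [r [/lw_letterV[d' Hd Ed] Hs /lw_letterV[r' Hr Er] E]]]]]].
have [n1 E1 Er'] := splitting_muV Hr.
have [s0 [s0' [q [t1 [A def_psi Ct Ed']]]]] := diagrammatic_cut Hd.
have [D [lw [lc [V Eq def_u2 Et1]]]] := cut_arrow_diagram Ct.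
subst u2; have [e Ee [def_u1 Es]] := shuffle_perm_tm (leaves_uniq D) Hs.
pose lb (h : hseg D) := match h with Top => s0 | Bottom => s0' | Cut c => lc c end.
have Te : Defs.typed P false u1 [:: psi] (diagram_tm P lw lb e).
  rewrite def_psi Eq def_u1; apply: ty_comp.
    by apply: ty_comp (ty_base _ _ _) (typed_inner_tm _ V); rewrite -Eq.
  by apply: typed_perm_tm => //; apply: leaves_uniq.
exists u1, (diagram_tm P lw lb e); split.
  split; first by split.
  exists D, lw, lb, e; split=> //.
  - apply/valid_diagramP; have [Sc Tc] := src_tgt_composite V.
    by rewrite -Eq in Sc Tc; case: A => a1 a2; split; rewrite //= ?a1 ?a2.
  - exact: perm_trans Ee (leaves_enum D).
  - by rewrite /diagram_target -Eq.
  - exact: eqt_refl.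
apply/eqt_sym/eqv_eqt; last first.
  rewrite E1; apply: ty_comp (typed_loc Te) (typed_muV_iter _ _).
by rewrite E Ed Er Er' Ed' Es Et1 Eq.
Qed.

End Diagrams.

(** * Composition graphs *)

Section Graphs.
Variables (O : obj_monoid) (B M : moncat O) (P : pointing B M).
Variable S : option (sym_pointing P).

Lemma valid_graph_iso (G H : bigraph) (h : bigraph_iso G H)
    (lw : white H -> mor M) (lb : black H -> mor B) :
  valid_graph lw lb ->
  valid_graph (fun x => lw (iso_w h x)) (fun v => lb (iso_b h v)).
Proof.
move=> V v; have [] := V (iso_b h v); rewrite iso_in iso_out -!map_comp.
have map_nil (T T' : Type) (f : T -> T') xs : xs <> [::] -> map f xs <> [::].
  by case: xs.
by move=> V1 V2; split=> n; [apply: V1 | apply: V2]; apply: map_nil.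
Qed.

Lemma box_roof_graph (phi psi : mor M) (w : word M) (Gam : tm B M) :
  box_roof S phi psi w Gam <-> graph_roof S phi psi w Gam.
Proof.
split=> -[R].
  move=> [d [lw [lb [e [V Ee Ew Et Eg]]]]]; split=> //.
  have id_bij T : bijective (@id T) by exists id.
  have map1 (T : Type) (s : seq T) : s = map id s by rewrite map_id.
  pose h := @BiGraphIso (dual d) (dual d) id id (id_bij _) (id_bij _)
    (fun v => map1 _ _) (fun v => map1 _ _).
  exists (dual d), lw, lb, e; split=> //; exists d, h, e; split=> //.
move=> [G [lw [lb [e [V Ee Ew [d [h [e' [def_e Et Eg]]]]]]]]]; split=> //.
exists d, (fun x => lw (iso_w h x)), (fun v => lb (iso_b h v)), e'; split=> //.
- exact: (valid_graph_iso h V).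
- have inj : injective (iso_w h) := bij_inj (iso_w_bij h).
  apply: uniq_perm; last 1 first.
  + move=> x; rewrite mem_enum -(mem_map inj) -def_e (perm_mem Ee).
    by rewrite mem_enum.
  + by rewrite -(map_inj_uniq inj) -def_e (perm_uniq Ee) enum_uniq.
  + exact: enum_uniq.
- by rewrite Ew def_e -map_comp.
Qed.

End Graphs.

(** * Roofs of box diagrams *)

Section Main.
Variables (O : obj_monoid) (B M : moncat O) (P : pointing B M).
Variable S : option (sym_pointing P).

Lemma normal_red_ten (phi1 phi2 psi1 psi2 : mor M) (t1 t2 : tm B M) :
  normal S [:: phi1] [:: psi1] t1 -> normal S [:: phi2] [:: psi2] t2 ->
  normal S [:: ten phi1 phi2] [:: ten psi1 psi2]
    (red_ten phi1 phi2 psi1 psi2 t1 t2).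
Proof.
move=> N1 N2; apply: normal_eqv
  (normal_sp_comp (dg_normal (lw_letter _ _ (dg_mu (dg_box _ _) (dg_box _ _)))
     (normal_box N1 N2)) (lw_letter _ _ (sp_muV (sp_id _ _) (sp_id _ _)))) _.
by rewrite /red_ten !box_id comp1r // comp1l.
Qed.

Lemma normal_base s s' (phi : mor M) : acts s s' phi ->
  normal S [:: phi] [:: act P s s' phi] (tbase s phi s').
Proof.
move=> A; apply: normal_eqv (normal_dg (lw_letter _ _ (dg_base A (dg_box _ _)))) _.
by rewrite comp1r.
Qed.

Lemma normal_gamma (phi psi : mor M) : src phi = tgt psi ->
  normal S [:: ten phi psi] [:: mcomp phi psi]
    (tcomp (tgamma B phi psi) (tmuV B phi psi)).
Proof.
move=> C; apply: normal_eqv (normal_sp_comp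
  (normal_dg (lw_letter _ _ (dg_gamma C (dg_box _ _) (dg_box _ _))))
  (lw_letter _ _ (sp_muV (sp_id _ _) (sp_id _ _)))) _.
by rewrite !box_id comp1r // comp1l.
Qed.

Lemma normal_swap (phi psi : mor M) :
  normal S [:: ten phi psi] [:: ten psi phi]
    (tcomp (tcomp (tmu B psi phi) (tswap B [:: phi] [:: psi])) (tmuV B phi psi)).
Proof.
apply: normal_eqv (normal_sp_comp (normal_shuffle
  (normal_dg (lw_letter _ _ (dg_mu (dg_box _ _) (dg_box _ _))))
  (sh_swap _ _ [:: phi] [:: psi]))
  (lw_letter _ _ (sp_muV (sp_id _ _) (sp_id _ _)))) _.
by rewrite !box_id comp1r // comp1l.
Qed.

(** The normal arrows satisfy the hypotheses of [reduced_ind]. *)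
Lemma normal_red (phi psi : mor M) t : localizable S -> red P phi psi t ->
  normal S [:: phi] [:: psi] t.
Proof.
move=> loc; apply: (reduced_ind (K := fun phi psi => normal S [:: phi] [:: psi])).
- by move=> phi' psi' t1 t2; apply: normal_eqv.
- by move=> phi' psi' chi t1 t2; apply: normal_comp.
- exact: normal_red_ten.
- exact: normal_base.
- exact: normal_gamma.
- exact: normal_swap.
Qed.

Lemma generated_mono (R R' : mor M -> mor M -> word M -> tm B M -> Prop) :
  (forall phi psi w Gam, R phi psi w Gam -> R' phi psi w Gam) ->
  forall phi psi t, generated S R phi psi t -> generated S R' phi psi t.
Proof.
move=> H phi psi t; elim=> {phi psi t}.
- by move=> *; apply: gen_roof; apply: H.
- by move=> phi psi chi g f _ ? _ ?; apply: gen_comp; eassumption.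
- by move=> *; apply: gen_ten.
- by move=> phi psi f g E _ ?; apply: gen_eq E _.
Qed.

Lemma generated_typed (R : mor M -> mor M -> word M -> tm B M -> Prop) :
  (forall phi psi w Gam, R phi psi w Gam -> roof P phi psi w Gam) ->
  forall phi psi t, generated S R phi psi t -> red P phi psi t.
Proof.
move=> H phi psi t; elim=> {phi psi t}.
- move=> phi psi w Gam /H[_ -> T].
  exact: ty_comp (typed_loc T) (typed_muV_iter P w).
- by move=> phi psi chi g f _ T _ T'; apply: ty_comp T T'.
- move=> phi1 psi1 phi2 psi2 f1 f2 _ T1 _ T2; apply: ty_comp (ty_muV _ _ _ _) => //.
  exact: ty_comp (ty_mu _ _ _ _) (ty_box T1 T2).
- by move=> phi psi f g /eqt_typed[].
Qed.

(** The generators of the reduced category are normal, hence roofs of box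
    diagrams. *)
Lemma red_generated (phi psi : mor M) t : red P phi psi t ->
  generated S (box_roof S) phi psi t.
Proof.
have typ := @generated_typed (box_roof S) (fun _ _ _ _ => @proj1 _ _).
have of_normal phi' psi' t' : normal S [:: phi'] [:: psi'] t' ->
    generated S (box_roof S) phi' psi' t'.
  move=> /normal_box_roof[w [Gam [R E]]].
  by apply: gen_eq (eqt_sym E) _; apply: gen_roof.
apply: (reduced_ind (S := S)).
- move=> phi' psi' t1 t2 Ht E; have T := typ _ _ _ Ht.
  exact: gen_eq (eqv_eqt E T) Ht.
- by move=> phi' psi' chi t1 t2; apply: gen_comp.
- by move=> *; apply: gen_ten.
- by move=> s s' phi' A; apply/of_normal/normal_base.
- by move=> phi' psi' C; apply/of_normal/normal_gamma.
- by move=> phi' psi'; apply/of_normal/normal_swap.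
Qed.
End Main.

Theorem theorem3p42 (O : obj_monoid) (B M : moncat O) (P : pointing B M)
    (S : option (sym_pointing P)) :
  (fully_factorizable S ->
     (forall (phi psi : mor M) (w1 w2 : word M) (Gam1 Gam2 : tm B M),
        roof P phi psi w1 Gam1 -> roof P phi psi w2 Gam2 ->
        (redE S phi psi (roof_mor w1 Gam1) (roof_mor w2 Gam2) <->
         roof_equiv S phi psi w1 Gam1 w2 Gam2)) /\
     (forall (phi psi : mor M) (f : tm B M), red P phi psi f ->
        exists (w : word M) (Gam : tm B M),
          [/\ box_roof S phi psi w Gam, graph_roof S phi psi w Gam &
              redE S phi psi f (roof_mor w Gam)])) /\
  (factorizable S ->
     forall (phi psi : mor M) (f : tm B M), red P phi psi f ->
       generated S (box_roof S) phi psi f /\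
       generated S (graph_roof S) phi psi f) /\
  (forall (phi psi : mor M) (w : word M) (Gam : tm B M),
     box_roof S phi psi w Gam <-> graph_roof S phi psi w Gam).
Proof.
split; last split.
- case=> _ loc; split=> [phi psi w1 w2 Gam1 Gam2|phi psi f /(normal_red loc)].
    by apply: roof_morP; case: loc.
  move=> /normal_box_roof[w [Gam [R E]]]; exists w, Gam; split=> //.
  exact/box_roof_graph.
- move=> _ phi psi f /(red_generated S) G; split=> //.
  by apply: generated_mono G => *; apply/box_roof_graph.
- by move=> *; apply: box_roof_graph.
Qed.
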